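(* There exist absolute constants $C,L>0$ such that for every bounded function $f\in C[0,1)$, every integer $n\ge 17$ and every integer $\ell\ge Ln$, $$K\Big(f,\frac{1}{n^2}\Big)\le C\,\frac{\ell^2}{n^2}\Big(\big\|\widetilde{M}_n f-f\big\|+\big\|\widetilde{M}_\ell f-f\big\|\Big).$$
   Context: $\|\cdot\|$ is the uniform norm on $[0,1)$ (essential supremum for functions defined only almost everywhere). Let $\varphi(x)=x(1-x)^2$ and $\widetilde{D}f(x)=\varphi(x)f''(x)$, $\widetilde{D}^2 f=\widetilde{D}(\widetilde{D}f)$; writing $\widetilde{D}h$ presupposes that $h,h'$ are locally absolutely continuous on $(0,1)$, so $\widetilde D h$ is defined a.e. For $n\in\mathbb{N}=\{1,2,\dots\}$, $k\ge 0$ and $x\in[0,1)$ let $P_{n,k}(x)=\binom{n+k}{k}x^k(1-x)^{n+1}$ and $\widetilde{P}_{n,k}(x)=P_{n,k}(x)-\frac1n\widetilde{D}P_{n,k}(x)$. For $f$ Lebesgue integrable on $(0,1)$ with finite limit $f(0)$ as $x\to0$ let $u_{n,0}(f)=f(0)$ and $u_{n,k}(f)=n\int_0^1P_{n,k-1}(t)(1-t)^{-2}f(t)\,dt$ for $k\ge1$. The operator is $$\widetilde{M}_n(f,x)=\sum_{k=0}^\infty u_{n,k}(f)\widetilde{P}_{n,k}(x),\qquad x\in[0,1).$$ $AC_{loc}(0,1)$ is the set of functions absolutely continuous on every $[a,b]\subset(0,1)$; $L_\infty[0,1)$ is the space of Lebesgue measurable essentially bounded functions on $[0,1)$. Let $W^2(\varphi)[0,1)=\{g: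 g,g'\in AC_{loc}(0,1),\ \widetilde{D}g\in L_\infty[0,1)\}$ (such $g$ have a finite limit at $0^+$, taken as $g(0)$), and let $W^2_0(\varphi)[0,1)$ be the subspace of those $g$ with $\lim_{x\to0^+}\widetilde{D}g(x)=0$. For $t>0$, $$K(f,t)=\inf\{\|f-g\|+t\|\widetilde{D}^2g\| : g\in W^2_0(\varphi)[0,1),\ \widetilde{D}g\in W^2(\varphi)[0,1)\}.$$ *)

(* Defs.v *)
From HB Require Import structures.
From mathcomp Require Import all_boot all_order all_algebra.
From mathcomp Require Import all_classical all_reals all_analysis.
From mathcomp Require Import measurable_realfun.

Set Implicit Arguments.
Unset Strict Implicit.
Unset Printing Implicit Defensive.

Import Order.TTheory GRing.Theory Num.Theory.
Import numFieldNormedType.Exports.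

Local Open Scope classical_set_scope.
Local Open Scope ring_scope.

(* Functions on [0,1) or (0,1) are represented by total functions R -> R whose
   values elsewhere are never used. *)

Section operator.
Context {R : realType}.
Implicit Types (f : R -> R) (n k : nat) (x : R).
Local Notation mu := (@lebesgue_measure R).

Definition phi x : R := x * (1 - x) ^+ 2.

(* [derive1] is total, with value 0 where the derivative does not exist; the
   regularity under which [Dt f] is meaningful a.e. is required in [W2]. *)
Definition Dt f : R -> R := fun x => phi x * derive1 (derive1 f) x.

Definition P n k : R -> R :=
  fun x => 'C(n + k, k)%:R * x ^+ k * (1 - x) ^+ n.+1.

Definition Pt n k : R -> R := fun x => P n k x - n%:R^-1 * Dt (P n k) x.

(* [f 0] stands for the limit of f at 0+, so f is meant to be
   right-continuous at 0. *)
Definition u n k f : R :=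
  if k is j.+1 then
    n%:R * \int[mu]_(t in `]0, 1[) (P n j t * (1 - t) ^- 2 * f t)
  else f 0.

Definition Mt n f : R -> R :=
  fun x => limn (series (fun k => u n k f * Pt n k x)).

End operator.

Section function_spaces.
Context {R : realType}.
Implicit Types (f g h : R -> R) (a b : R).
Local Notation mu := (@lebesgue_measure R).

Definition unif_norm f : \bar R :=
  ereal_sup [set `|f x|%:E | x in `[0, 1[].

Definition ess_norm h : \bar R :=
  ('N[mu]_(+oo) [EFin \o (h \_ `[0%R, 1%R[)])%E.

Definition abs_continuous a b f : Prop :=
  forall e : R, 0 < e -> exists2 d : R, 0 < d &
    forall (m : nat) (s t : 'I_m -> R),
      (forall i, [/\ a <= s i, s i <= t i & t i <= b]) ->
      trivIset setT (fun i => `]s i, t i[%classic) ->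
      \sum_(i < m) (t i - s i) < d ->
      \sum_(i < m) `|f (t i) - f (s i)| < e.

Definition AC_loc f : Prop :=
  forall a b, 0 < a -> a <= b -> b < 1 -> abs_continuous a b f.

(* Measurability with respect to the completed (Lebesgue) sigma-algebra on the
   domain, the Borel one on the codomain. *)
Definition Linfty h : Prop :=
  @measurable_fun _ _ (g_sigma_algebraType (completed_algebra_gen mu)) R
    `[0, 1[ h
  /\ (ess_norm h < +oo)%E.

Definition W2 g : Prop :=
  [/\ AC_loc g,
      forall x : R, 0 < x < 1 -> derivable g x 1,
      AC_loc (derive1 g)
    & Linfty (Dt g)].

Definition W2_0 g : Prop := W2 g /\ Dt g x @[x --> 0^'+] --> (0 : R).

(* The first conjunct is the convention that g(0) is the limit of g at 0+.
   Since [Dt g] only makes sense a.e., [W2 (Dt g)] should be read as being about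
   a continuous version of it; if there is one, then g', being absolutely
   continuous, is C^1 on (0,1) and [Dt g] itself is that version there. *)
Definition K f (t : R) : \bar R :=
  ereal_inf [set (unif_norm (f \- g)%R + t%:E * ess_norm (Dt (Dt g)))%E |
    g in [set g : R -> R | [/\ g x @[x --> 0^'+] --> g 0, W2_0 g & W2 (Dt g)]]].

End function_spaces.

(* Main.v *)
Require Import Defs.
From HB Require Import structures.
From mathcomp Require Import all_boot all_order all_algebra.
From mathcomp Require Import all_classical all_reals all_analysis.
From mathcomp Require Import measurable_realfun beta_distribution ess_sup_inf.
From mathcomp Require Import ring lra zify.

(** In the basis [P n k], the operator D = [Dt] acts on coefficients by a
    tridiagonal matrix Delta, and integration by parts shows that the
    functionals [u n k] intertwine D and Delta.  Hence the Goodman-Sharma operator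
    M_n f = sum_k u_{n,k}(f) P_{n,k} commutes with D, as does
    [Mt n] = (1 - D/n) M_n, and M_n - M_{n+1} = D M_n / (n(n+1)).
    Telescoping this relation twice, with c_l = sum_(j >= l) 1/(j(j+1)^2) ~ 1/(2l^2),
    [Mt l h - h = - sum_(j >= l) M_j D^2 h / (j(j+1)^2)], which differs from
    - c_l D^2 h by at most c_l |D^3 h| / l.  Since D [Mt n] is bounded with
    norm O(n), for h = [Mt n]^3 f and g = [Mt n]^2 f one has
    |D^3 h| <= 40 n |D^2 g| <= 40 n (|D^2 h| + (40 n)^2 |f - Mt n f|), and for
    l >= 80 n the term |D^2 h| / 2 is absorbed by the left-hand side. *)

Set Implicit Arguments.
Unset Strict Implicit.
Unset Printing Implicit Defensive.

Import Order.TTheory GRing.Theory Num.Theory.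
Import numFieldNormedType.Exports.

Local Open Scope classical_set_scope.
Local Open Scope ring_scope.

(** * Sums of series and the basis [P n k] *)

Section summation.
Context {R : realType}.
Implicit Types (u v a : nat -> R) (l M x : R) (n k : nat).

(** The entries of [Delta] grow like k (n + k), so [Delta] is unbounded on bounded sequences, and an
    O(n) bound for D [Mt n], which applies it twice, must come from cancellation. Two estimates
    supply it: the sum over k of |D P_{n,k}| is at most 2 (n + 1), and |Delta u_n(f)| is at most 8 n
    |f|. In both, the kernel becomes nonnegative once a part of mass O(n) is added. [Mt n] itself is
    not positive; positivity and pointwise convergence are only used for M_n. As f need not be
    differentiable, D is commuted with [Mt n] on expansions with bounded coefficients only, which
    one application of [Mt n] already provides. Three applications are taken because D^2 (g - h) is
    the square of D [Mt n] applied to f - [Mt n] f, while D^3 h is D [Mt n] applied to D^2 g. Thus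
    the error term of the Voronovskaya expansion is controlled by the very quantity D^2 h that is to
    be bounded, with a small factor n / l. *)

Definition has_sum u l := series u @ \oo --> l.

Lemma has_sum_unique u l l' : has_sum u l -> has_sum u l' -> l = l'.
Proof. by move=> h h'; rewrite -(cvg_lim _ h) // -(cvg_lim _ h'). Qed.

Lemma has_sum_ext u v l : (forall k, u k = v k) -> has_sum u l -> has_sum v l.
Proof. by move=> /funext ->. Qed.

Lemma has_sumD u v l l' : has_sum u l -> has_sum v l' -> has_sum (fun k => u k + v k) (l + l').
Proof.
move=> hu hv; rewrite /has_sum -[X in series X]/(u + v) seriesD.
exact: cvgD.
Qed.

Lemma has_sumZ c u l : has_sum u l -> has_sum (fun k => c * u k) (c * l).
Proof.
move=> hu; rewrite /has_sum -[X in series X]/(c *: u) seriesZ.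
exact: cvgMl_tmp hu.
Qed.
Arguments has_sumZ c {u l}.

Lemma has_sumB u v l l' : has_sum u l -> has_sum v l' -> has_sum (fun k => u k - v k) (l - l').
Proof.
move=> hu /(has_sumZ (-1)) hv.
have := has_sumD hu hv; rewrite mulN1r; apply: has_sum_ext => k; by rewrite mulN1r.
Qed.

Lemma has_sum_shift u l : has_sum (fun k => u k.+1) l <-> has_sum u (u 0%N + l).
Proof.
have E : series u = fun n => if n is m.+1 then u 0%N + series (u \o S) m else 0.
  apply/funext => -[|n]; first by rewrite /series/= big_geq.
  by rewrite /series/= big_nat_recl.
rewrite /has_sum E -(cvg_shiftS _ (nbhs (_ + l)))/=; split => h.
  by apply: cvgD => //; exact: cvg_cst.
have -> : l = - u 0%N + (u 0%N + l) by rewrite addKr.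
have -> : series (fun k => u k.+1) =
   (fun n => - u 0%N + (u 0%N + series (u \o S) n)).
  by apply/funext => n; rewrite addKr.
by apply: cvgD => //; exact: cvg_cst.
Qed.

Lemma has_sum_shift0 u l : u 0%N = 0 -> has_sum (fun k => u k.+1) l <-> has_sum u l.
Proof. by move=> u0; rewrite has_sum_shift u0 add0r. Qed.

Lemma has_sum_dominated u v l : (forall k, `|u k| <= v k) -> has_sum v l ->
  exists2 l', has_sum u l' & `|l'| <= l.
Proof.
move=> uv hv.
have v0 k : 0 <= v k by apply: le_trans (uv k).
have cu : cvgn (series (fun k => `|u k|)).
  by apply: series_le_cvg (cvgP _ hv) => // k; exact: normr_ge0.
exists (limn (series u)); first exact: (normed_cvg cu).
apply: (le_trans (lim_series_norm cu)).
by rewrite -(cvg_lim _ hv)//; apply: lim_series_le => //; exact: cvgP hv.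
Qed.

Lemma has_sum_nneg_bounded u M : (forall k, 0 <= u k) -> (forall n, series u n <= M) ->
  exists l, has_sum u l.
Proof.
move=> u0 uM; exists (limn (series u)).
apply: nondecreasing_is_cvgn; last by exists M => _ [n _ <-].
by apply/nondecreasing_seqP => n; rewrite /series/= big_nat_recr//= lerDl.
Qed.

Lemma has_sum_single (u : nat -> R) j : (forall k, k != j -> u k = 0) -> has_sum u (u j).
Proof.
move=> uj; rewrite /has_sum -(cvg_shiftn j.+1).
rewrite (_ : (fun n => _) = cst (u j)); first exact: cvg_cst.
apply/funext => n /=; rewrite /series/=.
rewrite (big_cat_nat (n:=j.+1))//= ?leq_addl// big_nat_recr//=.
rewrite big1_seq ?add0r ?[X in _ + X]big1_seq ?addr0//.
  move=> i; rewrite mem_index_iota => /andP[_ /andP[ij _]].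
  by apply: uj; rewrite gtn_eqF.
move=> i; rewrite mem_index_iota => /andP[_ /andP[_ ij]].
by apply: uj; rewrite ltn_eqF.
Qed.

(** Together with [PnS]: a factor x is traded for a shift of k, a factor 1 - x for a shift of n.
    Most identities between expansions below reduce to these two rules. *)
Lemma PS n k x :
  (n + k).+1%:R * x * P n k x = k.+1%:R * P n k.+1 x.
Proof.
rewrite /P [x ^+ k.+1]exprS addnS.
have := mul_bin_diag (n + k).+1 k => /= /(congr1 (fun m => m%:R : R)).
rewrite !natrM => E.
have -> : (n + k).+1%:R * x * ('C(n + k, k)%:R * x ^+ k * (1 - x) ^+ n.+1) =
  ((n + k).+1%:R * 'C(n + k, k)%:R) * x * x ^+ k * (1 - x) ^+ n.+1 by ring.
by rewrite E; ring.
Qed.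

Lemma PnS n k x :
  (n + k).+1%:R * (1 - x) * P n k x = n.+1%:R * P n.+1 k x.
Proof.
rewrite /P [(1 - x) ^+ n.+2]exprS addSn.
have := mul_bin_down (n + k).+1 k => /= /(congr1 (fun m => m%:R : R)).
rewrite subSn ?leq_addl// addnK !natrM => E.
have -> : (n + k).+1%:R * (1 - x) * ('C(n + k, k)%:R * x ^+ k * (1 - x) ^+ n.+1) =
  ((n + k).+1%:R * 'C(n + k, k)%:R) * x ^+ k * ((1 - x) * (1 - x) ^+ n.+1) by ring.
by rewrite E; ring.
Qed.

Lemma P_pascal n k x :
  P n.+1 k.+1 x = (1 - x) * P n k.+1 x + x * P n.+1 k x.
Proof.
rewrite /P !addSn addnS binS natrD [(1 - x) ^+ n.+2]exprS [x ^+ k.+1]exprS.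
by ring.
Qed.

Lemma P0k x k : P 0 k x = (1 - x) * x ^+ k.
Proof. by rewrite /P add0n binn expr1 mul1r mulrC. Qed.

Lemma P_ge0 n k x : 0 <= x -> x <= 1 -> 0 <= P n k x.
Proof. by move=> x0 x1; rewrite /P !mulr_ge0 ?exprn_ge0 ?subr_ge0. Qed.

Lemma has_sum_P n x : 0 <= x < 1 -> has_sum (fun k => P n k x) 1.
Proof.
move=> /andP[x0 x1]; have x1' : 0 < 1 - x by rewrite subr_gt0.
elim: n => [|n IH].
  apply: (@has_sum_ext (geometric (1 - x) x)); first by move=> k; rewrite P0k.
  have := @cvg_geometric_series R (1 - x) x; rewrite divff ?gt_eqF//.
  by apply; rewrite ger0_norm.
set r := series (fun k => P n k x) in IH *.
have rle N : r N <= 1.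
  rewrite -(cvg_lim _ IH)//; apply: nondecreasing_cvgn_le; last exact: cvgP IH.
  apply/nondecreasing_seqP => m; rewrite /r /series/= big_nat_recr//= lerDl.
  by rewrite P_ge0// ltW.
(* Pascal's rule summed over k <= N and solved for the partial sum. The boundary term vanishes in
   the limit, being a multiple of the general term of a convergent series. *)
have E N : series (fun k => P n.+1 k x) N.+1 =
     r N.+1 - x / (1 - x) * P n.+1 N x.
  elim: N => [|N IHN].
    rewrite /r /series/= !big_nat1 /P !addn0 !bin0 !expr0 [(1 - x) ^+ n.+2]exprS.
    by field; rewrite gt_eqF.
  have sS (u : nat -> R) m : series u m.+1 = series u m + u m.
    by rewrite /series/= big_nat_recr.
  by rewrite sS IHN /r [in RHS]sS P_pascal; field; rewrite gt_eqF.
have [l hl] : exists l, has_sum (fun k => P n.+1 k x) l.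
  apply: (@has_sum_nneg_bounded _ 1) => [k|[|N]]; first by rewrite P_ge0// ltW.
    by rewrite /series/= big_geq.
  rewrite E; have := rle N.+1; apply: le_trans.
  by rewrite gerBl mulr_ge0 ?P_ge0 ?divr_ge0// ltW.
have P0 : (P n.+1 k x) @[k --> \oo] --> 0.
  by apply: cvg_series_cvg_0; exact: cvgP hl.
rewrite /has_sum -cvg_shiftS.
have -> : (fun N => series (fun k => P n.+1 k x) N.+1) =
  (fun N => r N.+1 - x / (1 - x) * P n.+1 N x) by apply/funext.
suff : (r N.+1 - x / (1 - x) * P n.+1 N x) @[N --> \oo] -->
   1 - x / (1 - x) * 0 by rewrite mulr0 subr0.
apply: cvgB; first by move: IH; rewrite /has_sum -cvg_shiftS.
exact: cvgMl_tmp.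
Qed.

End summation.
Arguments has_sumZ {R} c {u l}.

(** * Expansions in the basis [P n k] *)

Section expansion.
Context {R : realType}.
Implicit Types (u v a c : nat -> R) (l M A x : R) (n k : nat).

Definition Psum n a x := limn (series (fun k => a k * P n k x)).

Lemma has_sum_S n a M x : (forall k, `|a k| <= M) -> 0 <= x < 1 ->
  has_sum (fun k => a k * P n k x) (Psum n a x) /\ `|Psum n a x| <= M.
Proof.
move=> aM x01; have /andP[x0 /ltW x1] := x01.
have [|l hl lM] := @has_sum_dominated _ (fun k => a k * P n k x)
   (fun k => M * P n k x) _ _ (has_sumZ M (has_sum_P n x01)).
  by move=> k; rewrite normrM (ger0_norm (P_ge0 n k x0 x1)) ler_wpM2r// P_ge0.
by rewrite /Psum (cvg_lim _ hl)//; split=> //; rewrite mulr1 in lM.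
Qed.

Lemma S_unique n a x l : has_sum (fun k => a k * P n k x) l -> Psum n a x = l.
Proof. by move=> h; rewrite /Psum (cvg_lim _ h). Qed.

(** By [PnS] used twice, (n + k + 1) (n + k + 2) P_{n,k} is a constant multiple of P_{n+2,k}, which
    is summable. This admits the quadratic growth that [Delta] produces. *)
Lemma has_sum_quad n c A x : 0 <= x < 1 ->
  (forall k, `|c k| <= A * (n + k).+1%:R * (n + k).+2%:R) ->
  exists l, has_sum (fun k => c k * P n k x) l.
Proof.
move=> x01 cA; have /andP[x0 x1] := x01.
have y0 : 0 < 1 - x by rewrite subr_gt0.
have [|l hl _] := @has_sum_dominated _ (fun k => c k * P n k x)
   (fun k => A * n.+1%:R * n.+2%:R / (1 - x) ^+ 2 * P n.+2 k x) _ _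
   (has_sumZ _ (has_sum_P n.+2 x01)); last by exists l.
move=> k; rewrite normrM (ger0_norm (P_ge0 n k x0 (ltW x1))).
have -> : A * n.+1%:R * n.+2%:R / (1 - x) ^+ 2 * P n.+2 k x =
   A * (n + k).+1%:R * (n + k).+2%:R * P n k x.
  have E1 := PnS n k x; have E2 := PnS n.+1 k x.
  rewrite addSn in E2.
  have -> : A * n.+1%:R * n.+2%:R / (1 - x) ^+ 2 * P n.+2 k x =
    A * n.+1%:R / (1 - x) ^+ 2 * (n.+2%:R * P n.+2 k x) by ring.
  rewrite -E2.
  have -> : A * n.+1%:R / (1 - x) ^+ 2 * ((n + k).+2%:R * (1 - x) * P n.+1 k x) =
   A / (1 - x) ^+ 2 * (n + k).+2%:R * (1 - x) * (n.+1%:R * P n.+1 k x) by ring.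
  by rewrite -E1; field; rewrite gt_eqF.
by rewrite ler_wpM2r// P_ge0// ltW.
Qed.

(** Without its factor (1 - x)^(n+1), an expansion is a power series in x, for which termwise
    differentiation is available. *)
Definition bcoef n a k := 'C(n + k, k)%:R * a k.
Definition Bsum n a x := limn (pseries (bcoef n a) x).

Lemma has_sum_B n a M x : (forall k, `|a k| <= M) -> 0 <= x < 1 ->
  has_sum (fun k => bcoef n a k * x ^+ k) (Bsum n a x) /\
  Psum n a x = (1 - x) ^+ n.+1 * Bsum n a x.
Proof.
move=> aM x01; have [hS _] := has_sum_S n aM x01.
have y0 : (1 - x) ^+ n.+1 != 0.
  by rewrite expf_neq0// subr_eq0 gt_eqF//; case/andP: x01.
have h : has_sum (fun k => bcoef n a k * x ^+ k) (((1 - x) ^+ n.+1)^-1 * Psum n a x).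
  apply: has_sum_ext (has_sumZ _ hS) => k; rewrite /P /bcoef.
  set z := _ ^+ n.+1 in y0 *; field.
  exact: y0.
have -> : Bsum n a x = ((1 - x) ^+ n.+1)^-1 * Psum n a x by rewrite /Bsum (cvg_lim _ h).
by split=> //; rewrite mulVKf.
Qed.

(** The binomial factor absorbs k + 1, so differentiation stays within the family: it raises n and
    shifts the coefficients. *)
Lemma pseries_diffs_bcoef n a :
  pseries_diffs (bcoef n a) = (fun k => n.+1%:R * bcoef n.+1 (a \o succn) k).
Proof.
apply/funext => k; rewrite /pseries_diffs /bcoef/= !mulrA; congr (_ * _).
rewrite -!natrM; congr (_%:R).
have := mul_bin_diag (n + k).+1 k => /=; rewrite addnS => <-.
have := mul_bin_down (n + k).+1 k => /=.
by rewrite subSn ?leq_addl// addnK addSn => ->.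
Qed.

Lemma is_derive_B n a M x : (forall k, `|a k| <= M) -> 0 <= x < 1 ->
  is_derive x 1 (Bsum n a) (n.+1%:R * Bsum n.+1 (a \o succn) x).
Proof.
move=> aM x01; have /andP[x0 x1] := x01.
(* Termwise differentiation at x asks that the series and its first two formal derivatives converge
   at a point beyond x; the midpoint of x and 1 serves. *)
pose K := (1 + x) / 2.
have K01 : 0 <= K < 1 by rewrite /K; apply/andP; split; lra.
have aM1 k : `|(a \o succn) k| <= M by exact: aM.
have aM2 k : `|((a \o succn) \o succn) k| <= M by exact: aM.
have cZ c r : cvgn (pseries c K) -> cvgn (pseries (fun k => r * c k) K).
  move=> h; have /has_sum_ext := has_sumZ r h; move/(_ (fun k => r * c k * K ^+ k)) => E.
  by apply: cvgP (E _) => k; rewrite mulrA.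
have cv m (a' : nat -> R) : (forall k, `|a' k| <= M) -> cvgn (pseries (bcoef m a') K).
  by move=> a'M; have [h _] := has_sum_B m a'M K01; exact: cvgP h.
have := @pseries_snd_diffs R (bcoef n a) K x.
rewrite pseries_diffs_bcoef.
have -> : pseries_diffs (fun k => n.+1%:R * bcoef n.+1 (a \o succn) k) =
   (fun k => n.+1%:R * pseries_diffs (bcoef n.+1 (a \o succn)) k).
  by apply/funext => k; rewrite /pseries_diffs mulrCA.
rewrite pseries_diffs_bcoef => /(_ (cv _ _ aM) (cZ _ _ (cv _ _ aM1))
   (cZ _ _ (cZ _ _ (cv _ _ aM2)))).
rewrite (ger0_norm x0) ger0_norm; last by case/andP: K01.
rewrite (_ : x < K); last by rewrite /K; lra.
move=> /(_ isT) h; apply: (is_derive_eq h) => {h}.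
have [h _] := has_sum_B n.+1 aM1 x01.
have := has_sumZ n.+1%:R h; move/(cvg_lim _) => <- //.
by congr (limn (series _)); apply/funext => k /=; rewrite mulrA.
Qed.

Lemma is_derive_ext (f g : R -> R) x d d' : is_derive x 1 g d ->
  (forall y, f y = g y) -> d = d' -> is_derive x 1 f d'.
Proof. by move=> h /funext -> <-. Qed.

Lemma is_derive_onemX n x :
  is_derive x 1 (fun y => (1 - y) ^+ n : R) (- n%:R * (1 - x) ^+ n.-1).
Proof.
have h : is_derive x 1 (fun y : R => 1 - y) (0 - 1).
  exact: (is_deriveB (is_derive_cst (1 : R) x 1) (is_derive_id x 1)).
apply: (is_derive_ext (is_deriveX n h)) => [y|]; first by rewrite fctE.
by rewrite /GRing.scale/=; ring.
Qed.

(** [G0], [G1], [G2] express [Psum n a] and its first two derivatives by power series. They are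
    differentiable from both sides at 0, whereas [Psum] is controlled on [0,1) only. The truncated
    exponent [n.-1] in [G2] comes with a factor n. *)
Definition G0 n a x := (1 - x) ^+ n.+1 * Bsum n a x.
Definition G1 n a x := n.+1%:R * ((1 - x) ^+ n.+1 * Bsum n.+1 (a \o succn) x
  - (1 - x) ^+ n * Bsum n a x).
Definition G2 n a x := n.+1%:R * (
  n.+2%:R * ((1 - x) ^+ n.+1 * Bsum n.+2 (a \o succn \o succn) x)
  - 2 * n.+1%:R * ((1 - x) ^+ n * Bsum n.+1 (a \o succn) x)
  + n%:R * ((1 - x) ^+ n.-1 * Bsum n a x)).

Lemma is_derive_XB m n a M x : (forall k, `|a k| <= M) -> 0 <= x < 1 ->
  is_derive x 1 (fun y => (1 - y) ^+ m * Bsum n a y)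
   ((1 - x) ^+ m * (n.+1%:R * Bsum n.+1 (a \o succn) x)
     + Bsum n a x * (- m%:R * (1 - x) ^+ m.-1)).
Proof.
move=> aM x01; apply: is_deriveM; first exact: is_derive_onemX.
exact: is_derive_B x01.
Qed.

Lemma is_derive_G0 n a M x : (forall k, `|a k| <= M) -> 0 <= x < 1 ->
  is_derive x 1 (G0 n a) (G1 n a x).
Proof.
move=> aM x01; have h0 := is_derive_XB n.+1 n aM x01; apply: (is_derive_eq h0) => {h0}.
by rewrite /G1/=; ring.
Qed.

Lemma is_derive_G1 n a M x : (forall k, `|a k| <= M) -> 0 <= x < 1 ->
  is_derive x 1 (G1 n a) (G2 n a x).
Proof.
move=> aM x01.
have h1 := is_derive_XB n.+1 n.+1 (a := a \o succn) (fun k => aM k.+1) x01.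
have h2 := is_derive_XB n n aM x01.
have h0 := is_deriveZ n.+1%:R (is_deriveB h1 h2); apply: (is_derive_eq h0) => {h0}.
by rewrite /G2 /GRing.scale/=; ring.
Qed.

Lemma derivable_G2 n a M x : (forall k, `|a k| <= M) -> 0 <= x < 1 ->
  derivable (G2 n a) x 1.
Proof.
move=> aM x01.
have h1 := is_derive_XB n.+1 n.+2 (a := a \o succn \o succn) (fun k => aM k.+2) x01.
have h2 := is_derive_XB n n.+1 (a := a \o succn) (fun k => aM k.+1) x01.
have h3 := is_derive_XB n.-1 n aM x01.
have h := is_deriveZ n.+1%:R (is_deriveD (is_deriveB (is_deriveZ n.+2%:R h1)
   (is_deriveZ (2 * n.+1%:R) h2)) (is_deriveZ n%:R h3)).
by case: (@is_derive_ext (G2 n a) _ _ _ _ h (fun y => erefl) erefl).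
Qed.
End expansion.

(** * The action of the differential operator on coefficients *)

Section generator.
Context {R : realType}.
Implicit Types (a c : nat -> R) (f g : R -> R) (l M A x : R) (n k : nat).

Definition DtP n k x := (n + k)%:R *
  (k.-1%:R * P n k.-1 x - 2 * k%:R * P n k x + k.+1%:R * P n k.+1 x).

(** The transpose of the matrix that expresses [DtP] in the basis. The factor k kills row 0, where
    [a k.-1] would read a wrong entry. *)
Definition Delta n a k := k%:R *
  ((n + k).+1%:R * a k.+1 - 2 * (n + k)%:R * a k + ((n + k)%:R - 1) * a k.-1).

(** By [PS], multiplication by x turns the neighbours of P_{n,k} into multiples of P_{n,k}; the
    remaining factor is a quadratic polynomial in x, whose sign can be studied. *)
Lemma mulx_Q n k x : x * DtP n k x = P n k x *
  (k%:R * (k%:R - 1) - 2 * k%:R * (n + k)%:R * x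
   + (n + k)%:R * (n + k).+1%:R * x ^+ 2).
Proof.
have E2 := PS n k x; rewrite /DtP; case: k E2 => [|k] E2.
  by rewrite -E2 !addn0/=; ring.
have E1 := PS n k x; rewrite -E2 /= addnS in E1 *.
have -> : x * ((n + k).+1%:R * (k%:R * P n k x - 2 * k.+1%:R * P n k.+1 x
   + (n + k).+2%:R * x * P n k.+1 x)) = k%:R * ((n + k).+1%:R * x * P n k x) +
   (n + k).+1%:R * x * P n k.+1 x * (- 2 * k.+1%:R + (n + k).+2%:R * x) by ring.
by rewrite E1 -[in k.+1%:R - 1]natr1; ring.
Qed.

(** D may be applied term by term: after [mulx_Q] the series splits into sums weighted by 1, k and k
    (k - 1), and index shifts turn these into the three power series of [G2]. *)
Lemma has_sum_Q n a M x : (forall k, `|a k| <= M) -> 0 < x < 1 ->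
  has_sum (fun k => a k * DtP n k x) (phi x * G2 n a x).
Proof.
move=> aM /andP[x0 x1].
have x01 : 0 <= x < 1 by rewrite ltW.
have y0 : 1 - x != 0 by rewrite subr_eq0 gt_eqF.
have [h0 _] := has_sum_S n aM x01; have [_ E0] := has_sum_B n aM x01.
have aM1 k : `|(a \o succn) k| <= M by exact: aM.
have aM2 k : `|(a \o succn \o succn) k| <= M by exact: aM.
have [h1 _] := has_sum_S n.+1 aM1 x01; have [_ E1] := has_sum_B n.+1 aM1 x01.
have [h2 _] := has_sum_S n.+2 aM2 x01; have [_ E2] := has_sum_B n.+2 aM2 x01.
rewrite {}E0 in h0; rewrite {}E1 in h1; rewrite {}E2 in h2.
have ht : has_sum (fun k => k%:R * P n k x * a k) (x * n.+1%:R / (1 - x) *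
   ((1 - x) ^+ n.+2 * Bsum n.+1 (a \o succn) x)).
  apply/(@has_sum_shift0 _ (fun k => k%:R * P n k x * a k)); first by rewrite !mul0r.
  apply: has_sum_ext (has_sumZ _ h1) => k; rewrite -PS/=.
  transitivity (x / (1 - x) * a k.+1 * (n.+1%:R * P n.+1 k x)); first by ring.
  by rewrite -PnS; field.
have hs2 : has_sum (fun k => k%:R * (k%:R - 1) * P n k x * a k)
   (x ^+ 2 * n.+1%:R * n.+2%:R / (1 - x) ^+ 2 *
   ((1 - x) ^+ n.+3 * Bsum n.+2 (a \o succn \o succn) x)).
  pose s k := k%:R * (k%:R - 1) * P n k x * a k.
  apply/(@has_sum_shift0 _ s); first by rewrite /s !mul0r.
  apply/(@has_sum_shift0 _ (fun k => s k.+1)); first by rewrite /s subrr !(mulr0, mul0r).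
  apply: has_sum_ext (has_sumZ _ h2) => k; rewrite /s/=.
  have F1 := PS n k.+1 x; have F2 := PS n k x.
  have F3 := PnS n.+1 k x; have F4 := PnS n k x.
  transitivity ((k.+2%:R - 1) * a k.+2 * (k.+2%:R * P n k.+2 x)); last by ring.
  rewrite -F1 -[k.+2%:R]natr1 addrK addnS.
  transitivity (a k.+2 * (n + k).+2%:R * x * (k.+1%:R * P n k.+1 x)); last by ring.
  rewrite -F2.
  transitivity (x ^+ 2 * n.+1%:R / (1 - x) ^+ 2 * a k.+2 * (n.+2%:R * P n.+2 k x)).
    by ring.
  rewrite -F3 addSn.
  transitivity (x ^+ 2 / (1 - x) * a k.+2 * (n + k).+2%:R * (n.+1%:R * P n.+1 k x)).
    by field.
  by rewrite -F4; field.
have h := has_sumZ x^-1 (has_sumD (has_sumB (has_sumZ ((1 - x) ^+ 2) hs2)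
  (has_sumZ (2 * n.+1%:R * x * (1 - x)) ht)) (has_sumZ (n%:R * n.+1%:R * x ^+ 2) h0)).
have -> : phi x * G2 n a x = x^-1 * ((1 - x) ^+ 2 * (x ^+ 2 * n.+1%:R * n.+2%:R / (1 - x) ^+ 2 *
   ((1 - x) ^+ n.+3 * Bsum n.+2 (a \o succn \o succn) x)) -
   2 * n.+1%:R * x * (1 - x) * (x * n.+1%:R / (1 - x) *
   ((1 - x) ^+ n.+2 * Bsum n.+1 (a \o succn) x)) +
   n%:R * n.+1%:R * x ^+ 2 * ((1 - x) ^+ n.+1 * Bsum n a x)).
  rewrite /phi /G2; have x0' : x != 0 by rewrite gt_eqF.
  case: (n) => [|m]; rewrite ?[(1 - x) ^+ _.+1]exprS; field; rewrite ?x0' ?y0//.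
apply: has_sum_ext h => k.
have -> : a k * DtP n k x = x^-1 * (a k * (x * DtP n k x)) by field; rewrite gt_eqF.
by rewrite mulx_Q natrD -!natr1 natrD; ring.
Qed.

(** Summation by parts: the three diagonals converge separately by [has_sum_quad] and can therefore
    be reindexed one by one. *)
Lemma has_sum_Delta n a M x l : (forall k, `|a k| <= M) -> 0 <= x < 1 ->
  has_sum (fun k => a k * DtP n k x) l -> has_sum (fun k => Delta n a k * P n k x) l.
Proof.
move=> aM x01 hQ.
have M0 : 0 <= M by apply: le_trans (aM 0%N).
have [W hW] : exists l', has_sum (fun k => k%:R * (n + k).+1%:R * a k.+1 * P n k x) l'.
  apply: (@has_sum_quad _ n (fun k => k%:R * (n + k).+1%:R * a k.+1) M) => // k.
  rewrite !normrM !normr_nat mulrC -[leRHS]mulrA ler_pM//.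
  rewrite mulrC ler_pM// ler_nat; lia.
have [V hV] : exists l', has_sum (fun k => k%:R * ((n + k)%:R - 1) * a k.-1 * P n k x) l'.
  apply: (@has_sum_quad _ n (fun k => k%:R * ((n + k)%:R - 1) * a k.-1) M) => // k.
  rewrite !normrM !normr_nat mulrC -[leRHS]mulrA ler_pM//.
  case: k => [|k]; first by rewrite mul0r.
  rewrite addnS -[X in `|X - 1|]natr1 addrK normr_nat mulrC ler_pM// ler_nat; lia.
have [U hU] : exists l', has_sum (fun k => 2 * k%:R * (n + k)%:R * a k * P n k x) l'.
  apply: (@has_sum_quad _ n (fun k => 2 * k%:R * (n + k)%:R * a k) (2 * M)) => // k.
  rewrite !normrM !normr_nat -!mulrA ler_wpM2l//.
  rewrite mulrA mulrC ler_pM// ler_pM// ler_nat; lia.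
have hW' : has_sum (fun k => if k is j.+1 then
    j%:R * (n + j).+1%:R * a j.+1 * P n j x else 0) W.
  exact/(@has_sum_shift0 _ (fun k => if k is j.+1 then
    j%:R * (n + j).+1%:R * a j.+1 * P n j x else 0)).
have hV' := (@has_sum_shift0 _ (fun k => k%:R * ((n + k)%:R - 1) * a k.-1 * P n k x) V _).2 hV.
have {hV'}hV' := hV' (ltac:(by rewrite !mul0r)).
have -> : l = W - U + V.
  apply: has_sum_unique hQ (has_sum_ext _ (has_sumD (has_sumB hW' hU) hV')) => -[|k].
    by rewrite /DtP /= !addn0 addn1 -[n.+1%:R]natr1; ring.
  rewrite /DtP /= !addnS -[(n + k).+2%:R]natr1 addrK; ring.
by apply: has_sum_ext (has_sumD (has_sumB hW hU) hV) => k; rewrite /Delta; ring.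
Qed.

Lemma Q0 n k : DtP n k (0 : R) = 0.
Proof.
have P0 j : (0 < j)%N -> P n j (0 : R) = 0.
  by case: j => // j _; rewrite /P exprS mul0r mulr0 mul0r.
rewrite /DtP (P0 k.+1)//; case: k => [|[|k]] /=; first by ring.
  by rewrite (P0 1%N)//; ring.
by rewrite (P0 k.+1)// (P0 k.+2)//; ring.
Qed.

(** D annihilates constants: [Delta] of a constant sequence is 0. *)
Lemma has_sum_Q1 n x : 0 <= x < 1 -> has_sum (fun k => DtP n k x) 0.
Proof.
move=> x01; have /andP[x0 x1] := x01.
move: x0; rewrite le_eqVlt => /predU1P[<-|x0].
  apply: has_sum_ext (@has_sum_single _ (fun=> 0) 0%N _) => // k; by rewrite Q0.
have b1 k : `|(fun=> 1 : R) k| <= 1 by rewrite normr1.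
have h := @has_sum_Q n (fun=> 1) 1 x b1 ltac:(by rewrite x0).
have h' := has_sum_Delta b1 x01 h.
have E : phi x * G2 n (fun=> 1) x = 0.
  apply: has_sum_unique h' (has_sum_ext _ (@has_sum_single _ (fun=> 0) 0%N _)) => // k.
  by rewrite /Delta -natr1; ring.
by rewrite E in h; apply: has_sum_ext h => k; rewrite mul1r.
Qed.

(* [x * DtP n k x / P n k x] is [(k - (n + k + 1) x)^2] minus
   [k (1 - x)^2 + (n + 1) x^2]; the subtracted part sums to [(n + 1) x] against
   [P n k], and [DtP n k] itself sums to 0. *)
Lemma has_sum_normQ n a M x : (forall k, `|a k| <= M) -> 0 <= x < 1 ->
  exists2 l, has_sum (fun k => a k * DtP n k x) l & `|l| <= 2 * n.+1%:R * M.
Proof.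
move=> aM x01; have /andP[x0 x1] := x01.
(* By [PS] and [PnS], k (1 - x)^2 P_{n,k} = (n + 1) x (1 - x) P_{n+1,k-1}, so the total mass of this
   part is known as well. *)
pose p k := if k is j.+1 then P n.+1 j x else 0.
have hp : has_sum p 1 by apply/(@has_sum_shift0 _ p) => //; exact: has_sum_P.
have h := has_sumZ M (has_sumD (has_sum_Q1 n x01) (has_sumZ (2 * n.+1%:R) (has_sumD (has_sumZ (1 - x) hp)
   (has_sumZ x (has_sum_P n x01))))).
have [|l hl lM] := @has_sum_dominated _ (fun k => a k * DtP n k x) _ _ _ h; last first.
  exists l => //; apply: le_trans lM _.
  by rewrite add0r !mulr1 subrK mulr1 mulrC.
move=> k; rewrite normrM ler_pM//.
have pk0 : 0 <= p k by rewrite /p; case: k => // k; rewrite P_ge0// ltW.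
move: x0; rewrite le_eqVlt => /predU1P[x0|x0].
  rewrite -x0 Q0 normr0 add0r mul0r addr0 subr0 mul1r; apply: mulr_ge0 pk0.
  exact: mulr_ge0.
set T := (X in _ <= _ + X).
have T0 : 0 <= T.
  apply: mulr_ge0; first exact: mulr_ge0.
  apply: addr_ge0; first by apply: mulr_ge0 pk0; rewrite subr_ge0 ltW.
  by rewrite mulr_ge0 ?P_ge0 ?ltW.
(* |y| <= y + T holds as soon as T and 2 y + T are nonnegative. Summed over k, y gives 0 and T gives
   2 (n + 1). *)
suff : 0 <= 2 * DtP n k x + T by move=> H; rewrite ler_norml; apply/andP; split; lra.
rewrite -(pmulr_rge0 _ x0).
have -> : x * (2 * DtP n k x + T) = 2 * (P n k x * (k%:R - (n + k).+1%:R * x) ^+ 2).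
  rewrite mulrDr mulrCA mulx_Q /T /p; case: k {T T0 pk0} => [|k].
    by rewrite !addn0 -natr1; ring.
  transitivity (2 * (P n k.+1 x *
   (k.+1%:R * (k.+1%:R - 1) - 2 * k.+1%:R * (n + k.+1)%:R * x +
    (n + k.+1)%:R * (n + k.+1).+1%:R * x ^+ 2)) +
    2 * (x * (1 - x) * (n.+1%:R * P n.+1 k x) + n.+1%:R * x ^+ 2 * P n k.+1 x)).
    by ring.
  rewrite -PnS.
  transitivity (2 * (P n k.+1 x *
   (k.+1%:R * (k.+1%:R - 1) - 2 * k.+1%:R * (n + k.+1)%:R * x +
    (n + k.+1)%:R * (n + k.+1).+1%:R * x ^+ 2)) +
    2 * ((1 - x) ^+ 2 * ((n + k).+1%:R * x * P n k x) + n.+1%:R * x ^+ 2 * P n k.+1 x)).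
    by ring.
  by rewrite PS !addnS -!natr1 natrD; ring.
by rewrite mulr_ge0// mulr_ge0 ?sqr_ge0 ?P_ge0 ?ltW.
Qed.

Lemma S_Delta n a M x : (forall k, `|a k| <= M) -> 0 <= x < 1 ->
  [/\ has_sum (fun k => a k * DtP n k x) (Psum n (Delta n a) x),
      has_sum (fun k => Delta n a k * P n k x) (Psum n (Delta n a) x),
      `|Psum n (Delta n a) x| <= 2 * n.+1%:R * M &
      phi x * G2 n a x = Psum n (Delta n a) x].
Proof.
move=> aM x01; have [l hl lM] := has_sum_normQ n aM x01.
have h := has_sum_Delta aM x01 hl; have E := S_unique h; rewrite E; split => //.
have /andP[x0 x1] := x01.
move: x0; rewrite le_eqVlt => /predU1P[x0|x0]; last first.
  by apply: has_sum_unique hl; apply: has_sum_Q aM _; rewrite x0.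
rewrite /phi -x0 !mul0r; apply: has_sum_unique hl.
rewrite -x0; apply: has_sum_ext (@has_sum_single _ (fun=> 0) 0%N _) => // k.
by rewrite Q0 mulr0.
Qed.

End generator.

(** * The operators on functions *)

Section differential_operator.
Context {R : realType}.
Implicit Types (a c : nat -> R) (f g : R -> R) (l M A x : R) (n k : nat).
Local Notation mu := (@lebesgue_measure R).

Lemma near01 x (Pr : R -> Prop) : 0 < x < 1 ->
  (forall y, 0 < y < 1 -> Pr y) -> \forall y \near x, Pr y.
Proof.
move=> x01 h.
have : \forall y \near x, y \in `]0, 1[%R by apply: near_in_itvoo; rewrite in_itv.
by apply: filterS => y; rewrite in_itv/=; exact: h.
Qed.

Lemma derive1_ext f g x : 0 < x < 1 ->
  (forall y, 0 < y < 1 -> f y = g y) -> derive1 f x = derive1 g x.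
Proof.
by move=> x01 fg; rewrite !derive1E; apply: near_eq_derive; exact: near01.
Qed.

Lemma Dt0 f : Dt f 0 = 0 :> R.
Proof. by rewrite /Dt /phi !mul0r. Qed.

(** Inside (0,1) derivatives are local, and at 0 the factor [phi] vanishes whatever the derivative
    there. Hence [Dt] is insensitive to the values outside [0,1). *)
Lemma Dt_ext f g x : 0 <= x < 1 ->
  (forall y, 0 <= y < 1 -> f y = g y) -> Dt f x = Dt g x.
Proof.
move=> /andP[]; rewrite le_eqVlt => /predU1P[<-|x0] x1 fg; first by rewrite !Dt0.
rewrite /Dt; congr (_ * _); apply: derive1_ext; rewrite ?x0// => y y01.
by apply: derive1_ext => // z /andP[z0 z1]; apply: fg; rewrite ltW.
Qed.

Lemma S_G0 n a M x : (forall k, `|a k| <= M) -> 0 <= x < 1 -> Psum n a x = G0 n a x.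
Proof. by move=> aM x01; have [_ ->] := has_sum_B n aM x01. Qed.

Lemma derive1_S n a M x : (forall k, `|a k| <= M) -> 0 < x < 1 ->
  derive1 (Psum n a) x = G1 n a x.
Proof.
move=> aM x01; have /andP[x0 x1] := x01.
have x01' : 0 <= x < 1 by rewrite ltW.
rewrite (@derive1_ext _ (G0 n a))//; last first.
  by move=> y /andP[y0 y1]; apply: S_G0 aM _; rewrite ltW.
rewrite derive1E; have h := is_derive_G0 n aM x01'; exact: derive_val.
Qed.

Lemma derive2_S n a M x : (forall k, `|a k| <= M) -> 0 < x < 1 ->
  derive1 (derive1 (Psum n a)) x = G2 n a x.
Proof.
move=> aM x01; have /andP[x0 x1] := x01.
have x01' : 0 <= x < 1 by rewrite ltW.
rewrite (@derive1_ext _ (G1 n a))//; last by move=> y; exact: derive1_S.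
rewrite derive1E; have h := is_derive_G1 n aM x01'; exact: derive_val.
Qed.

Lemma Dt_S_G2 n a M x : (forall k, `|a k| <= M) -> 0 <= x < 1 ->
  Dt (Psum n a) x = phi x * G2 n a x.
Proof.
move=> aM /andP[]; rewrite le_eqVlt => /predU1P[<-|x0] x1.
  by rewrite Dt0 /phi !mul0r.
by rewrite /Dt (derive2_S n aM)// x0.
Qed.

Lemma Dt_S n a M x : (forall k, `|a k| <= M) -> 0 <= x < 1 ->
  Dt (Psum n a) x = Psum n (Delta n a) x.
Proof.
by move=> aM x01; rewrite (Dt_S_G2 n aM)//; have [_ _ _ ->] := S_Delta n aM x01.
Qed.

Lemma Dt_P n k x : 0 <= x < 1 -> Dt (P n k) x = DtP n k x.
Proof.
(* [P n k] is the expansion with the indicator of k as coefficients. *)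
move=> x01; pose d j : R := (j == k)%:R.
have d1 j : `|d j| <= 1 by rewrite /d normr_nat; case: eqP.
rewrite (@Dt_ext _ (Psum n d))//; last first.
  move=> y y01; apply/esym/S_unique.
  have := @has_sum_single _ (fun j => d j * P n j y) k.
  rewrite /d eqxx mul1r; apply => j jk.
  by rewrite (negbTE jk) mul0r.
rewrite (Dt_S n d1)//; have [h _ _ _] := S_Delta n d1 x01.
apply: has_sum_unique h _; have := @has_sum_single _ (fun j => d j * DtP n j x) k.
rewrite /d eqxx mul1r; apply => j jk.
by rewrite (negbTE jk) mul0r.
Qed.

(* The coefficients of [Mt n f] in the basis [P n k]. *)
Definition ut n f k := u n k f - n%:R^-1 * Delta n (u n ^~ f) k.

Lemma Mt_S n f M x : (forall k, `|u n k f| <= M) -> 0 <= x < 1 ->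
  has_sum (fun k => ut n f k * P n k x) (Mt n f x) /\ Mt n f x = Psum n (ut n f) x.
Proof.
move=> uM x01; have [h0 _] := has_sum_S n uM x01.
have [hQ hD _ _] := S_Delta n uM x01.
have -> : Mt n f x = Psum n (u n ^~ f) x - n%:R^-1 * Psum n (Delta n (u n ^~ f)) x.
  apply: cvg_lim => //; apply: has_sum_ext (has_sumB h0 (has_sumZ n%:R^-1 hQ)) => k.
  by rewrite /Pt Dt_P//; ring.
have h : has_sum (fun k => ut n f k * P n k x)
    (Psum n (u n ^~ f) x - n%:R^-1 * Psum n (Delta n (u n ^~ f)) x).
  by apply: has_sum_ext (has_sumB h0 (has_sumZ n%:R^-1 hD)) => k; rewrite /ut; ring.
by split => //; rewrite (S_unique h).
Qed.

Local Notation oi := (`]0, 1[%classic : set R).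

(** Measurability on (0,1) serves the integrals in [u]; the bound includes the point 0 because
    [u n 0 f] is [f 0]. *)
Definition bounded_by f M :=
  measurable_fun oi f /\ forall x, 0 <= x < 1 -> `|f x| <= M.

Lemma bounded_by_ge0 f M : bounded_by f M -> 0 <= M.
Proof. by case=> _ /(_ 0); rewrite lexx ltr01 => /(_ isT); exact: le_trans. Qed.

Lemma bounded_by_ext f g M : (forall x, 0 <= x < 1 -> g x = f x) -> bounded_by f M -> bounded_by g M.
Proof.
move=> fg [mf fM]; split; last by move=> x x01; rewrite fg//; exact: fM.
apply: eq_measurable_fun mf => x; rewrite inE/= in_itv/= => /andP[x0 x1].
by rewrite fg// ltW.
Qed.

Lemma bounded_byB f g M A : bounded_by f M -> bounded_by g A -> bounded_by (f \- g) (M + A).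
Proof.
move=> [mf fM] [mg gM]; split; first exact: measurable_funB.
by move=> x x01 /=; rewrite (le_trans (ler_normB _ _))// lerD ?fM ?gM.
Qed.

Lemma integrable_oi f M : measurable_fun oi f ->
  (forall x, 0 < x < 1 -> `|f x| <= M) -> mu.-integrable oi (EFin \o f).
Proof.
move=> mf fM; apply: measurable_bounded_integrable => //.
  by rewrite /= lebesgue_measure_itv/= lte01 oppr0 adde0 ltry.
exists M; split; first exact: num_real.
move=> y My x /=; rewrite in_itv/= => x01.
by apply: le_trans (ltW My); exact: fM.
Qed.

(** * Integrals against beta weights *)

Definition beta_int p q f := \int[mu]_(t in oi) (t ^+ p * (1 - t) ^+ q * f t).

Lemma mono_ge0 p q x : 0 < x < 1 -> 0 <= x ^+ p * (1 - x) ^+ q.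
Proof.
move=> /andP[x0 x1]; rewrite mulr_ge0// exprn_ge0//; first exact: ltW.
by rewrite subr_ge0 ltW.
Qed.

Lemma mono_le1 p q x : 0 < x < 1 -> x ^+ p * (1 - x) ^+ q <= 1.
Proof.
move=> /andP[x0 x1]; rewrite mulr_ile1 ?exprn_ge0 ?exprn_ile1 ?subr_ge0//; lra.
Qed.

Lemma measurable_mono p q : measurable_fun oi (fun x : R => x ^+ p * (1 - x) ^+ q).
Proof.
apply/measurable_funM => //; apply/measurable_funX => //.
exact: measurable_funB.
Qed.

Lemma integrable_J p q f M : bounded_by f M ->
  mu.-integrable oi (EFin \o (fun t => t ^+ p * (1 - t) ^+ q * f t)).
Proof.
move=> [mf fM]; apply: (@integrable_oi _ M).
  by apply: measurable_funM => //; exact: measurable_mono.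
move=> x x01; rewrite normrM ger0_norm ?mono_ge0//.
apply: le_trans (_ : 1 * M <= M); last by rewrite mul1r.
rewrite ler_pM ?mono_ge0 ?mono_le1// fM//.
by case/andP: x01 => /ltW -> ->.
Qed.

Lemma beta_int_norm p q f M : bounded_by f M -> `|beta_int p q f| <= M * beta_int p q (cst 1).
Proof.
move=> fM; have M0 := bounded_by_ge0 fM.
have b1 : bounded_by (cst 1) 1 by split => // x _ /=; rewrite normr1.
have i1 := integrable_J p q b1; have i := integrable_J p q fM.
rewrite /beta_int; apply: le_trans (le_normr_Rintegral _ i) _ => //.
rewrite -RintegralZl//; apply: le_Rintegral => //.
- exact: (integrable_norm i).
- exact: (integrableZl _ M i1).
- move=> x; rewrite /= in_itv/= => x01; rewrite normrM ger0_norm ?mono_ge0//.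
  rewrite mulr1 mulrC ler_wpM2r ?mono_ge0//; case: fM => _; apply.
  by case/andP: x01 => /ltW -> ->.
Qed.

Lemma beta_int_ge0 p q f : (forall x, 0 < x < 1 -> 0 <= f x) -> 0 <= beta_int p q f.
Proof.
move=> f0; apply: Rintegral_ge0 => x; rewrite /= in_itv/= => x01.
by rewrite mulr_ge0 ?mono_ge0 ?f0.
Qed.

Lemma beta_int_ext p q f g : (forall x, 0 < x < 1 -> f x = g x) -> beta_int p q f = beta_int p q g.
Proof.
move=> fg; apply: eq_Rintegral => x; rewrite inE/= in_itv/= => x01.
by rewrite fg.
Qed.

Lemma beta_intD p q f g M A : bounded_by f M -> bounded_by g A ->
  beta_int p q (fun t => f t + g t) = beta_int p q f + beta_int p q g.
Proof.
move=> fM gA; rewrite /beta_int -RintegralD//; last 2 first.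
- exact: integrable_J fM.
- exact: integrable_J gA.
by apply: eq_Rintegral => x _; rewrite mulrDr.
Qed.

Lemma beta_intZ p q f M (c : R) : bounded_by f M -> beta_int p q (fun t => c * f t) = c * beta_int p q f.
Proof.
move=> fM; rewrite /beta_int -RintegralZl//; last exact: integrable_J fM.
by apply: eq_Rintegral => x _; rewrite mulrCA.
Qed.

Lemma beta_int_x p q f : beta_int p.+1 q f = beta_int p q (fun t => t * f t).
Proof. by apply: eq_Rintegral => x _; rewrite exprS; ring. Qed.

Lemma beta_int_1x p q f M : bounded_by f M -> beta_int p q.+1 f = beta_int p q f - beta_int p.+1 q f.
Proof.
move=> fM; rewrite /beta_int -RintegralB//; [|exact: integrable_J fM..].
by apply: eq_Rintegral => x _; rewrite !exprS; ring.
Qed.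

Lemma beta_int_1 p q : beta_int p q (cst 1) = p`!%:R * q`!%:R / (p + q).+1`!%:R.
Proof.
have b1 : bounded_by (cst 1) 1 by split => // x _ /=; rewrite normr1.
rewrite -natrM -beta_fun_fact /beta_fun -Rintegral_mkcond /beta_int.
have := integrable_J p q b1.
rewrite /Rintegral => i; congr fine.
rewrite [RHS](@integral_itv_bndoo R 0 1 _ true false); last first.
  by apply/measurable_EFinP; exact: measurable_XMonemX.
by apply: eq_integral => x _; rewrite /XMonemX mulr1.
Qed.

End differential_operator.

(** * The functionals [u n k] *)

Section coefficients.
Context {R : realType}.
Implicit Types (f g : R -> R) (l M A x : R) (n k m i j p q : nat).
Local Notation mu := (@lebesgue_measure R).
Local Notation oi := (`]0, 1[%classic : set R).

Lemma bounded_by_cst (c : R) M : `|c| <= M -> bounded_by (cst c) M.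
Proof. by move=> cM; split. Qed.

Lemma bounded_byD f g M A : bounded_by f M -> bounded_by g A -> bounded_by (fun t => f t + g t) (M + A).
Proof.
move=> [mf fM] [mg gM]; split; first exact: measurable_funD.
by move=> x x01 /=; rewrite (le_trans (ler_normD _ _))// lerD ?fM ?gM.
Qed.

Lemma bounded_byZ (c : R) f M : bounded_by f M -> bounded_by (fun t => c * f t) (`|c| * M).
Proof.
move=> [mf fM]; split; first exact: measurable_funM.
by move=> x x01 /=; rewrite normrM ler_wpM2l// fM.
Qed.

Lemma bounded_by_mono p q f M : bounded_by f M -> bounded_by (fun t => t ^+ p * (1 - t) ^+ q * f t) M.
Proof.
move=> [mf fM]; split.
  by apply: measurable_funM => //; exact: measurable_mono.
move=> x x01; rewrite normrM; have /andP[x0 x1] := x01.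
have y0 : 0 <= 1 - x by rewrite subr_ge0 ltW.
have h0 : 0 <= x ^+ p * (1 - x) ^+ q by rewrite mulr_ge0// exprn_ge0.
rewrite ger0_norm//; apply: le_trans (_ : 1 * M <= M); last by rewrite mul1r.
rewrite ler_pM// ?fM//.
by rewrite mulr_ile1 ?exprn_ge0 ?exprn_ile1//; lra.
Qed.

Lemma beta_int_mono p q i j f :
  beta_int p q (fun t => t ^+ i * (1 - t) ^+ j * f t) = beta_int (p + i) (q + j) f.
Proof. by apply: eq_Rintegral => x _; rewrite !exprD; ring. Qed.

Lemma beta_int_le p q f M : bounded_by f M -> beta_int p q f <= M * beta_int p q (cst 1).
Proof. by move=> fM; apply: le_trans (ler_norm _) (beta_int_norm p q fM). Qed.

(** Expansion of the integral of the square of a (1 - t) - b t times f against the weight t^i (1 -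
    t)^m. *)
Lemma beta_int_sq i m f M (a b : R) : bounded_by f M -> (forall x, 0 < x < 1 -> 0 <= f x) ->
  0 <= a ^+ 2 * beta_int i m.+2 f - 2 * a * b * beta_int i.+1 m.+1 f + b ^+ 2 * beta_int i.+2 m f.
Proof.
move=> fM f0.
have h0 := bounded_byZ (a ^+ 2) (bounded_by_mono 0 2 fM).
have h1 := bounded_byZ (- (2 * a * b)) (bounded_by_mono 1 1 fM).
have h2 := bounded_byZ (b ^+ 2) (bounded_by_mono 2 0 fM).
have := @beta_int_ge0 R i m (fun t => (a * (1 - t) - b * t) ^+ 2 * f t).
rewrite (@beta_int_ext _ i m _ (fun t => a ^+ 2 * (t ^+ 0 * (1 - t) ^+ 2 * f t) +
   - (2 * a * b) * (t ^+ 1 * (1 - t) ^+ 1 * f t) +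
   b ^+ 2 * (t ^+ 2 * (1 - t) ^+ 0 * f t))); last by move=> x _; ring.
rewrite (beta_intD _ _ (bounded_byD h0 h1) h2) (beta_intD _ _ h0 h1).
rewrite (beta_intZ _ _ _ (bounded_by_mono 0 2 fM)) (beta_intZ _ _ _ (bounded_by_mono 1 1 fM)).
rewrite (beta_intZ _ _ _ (bounded_by_mono 2 0 fM)) !beta_int_mono !addn0 !addn1 !addn2 mulNr.
by apply=> x x01; rewrite mulr_ge0 ?sqr_ge0 ?f0.
Qed.

(** The inverse of the beta integral of t^j (1 - t)^m, see [ucoef_J1]: it makes [u m.+1 j.+1] an
    average. *)
Definition ucoef m j : R := m.+1%:R * 'C(m.+1 + j, j)%:R.

Lemma ucoef_gt0 m j : 0 < ucoef m j.
Proof. by rewrite /ucoef mulr_gt0// ltr0n bin_gt0 leq_addl. Qed.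

Lemma ucoef_ratio m j : j.+1%:R * ucoef m j.+1 = (m + j).+2%:R * ucoef m j.
Proof.
rewrite /ucoef !addSn !addnS mulrCA [RHS]mulrCA; congr (_ * _).
by have := mul_bin_diag (m + j).+2 j => /= /(congr1 (fun m => m%:R : R)); rewrite !natrM.
Qed.

Lemma ucoef_up m j : m.+1%:R * ucoef m.+1 j = (m + j).+2%:R * ucoef m j.
Proof.
rewrite /ucoef !addSn.
have := mul_bin_down (m + j).+2 j => /= /(congr1 (fun m => m%:R : R)).
rewrite !natrM (_ : ((m + j).+2 - j)%N = m.+2); last by lia.
move=> E; rewrite [RHS]mulrCA E; ring.
Qed.

Lemma ucoef_J1 m j : ucoef m j * beta_int j m (cst 1) = 1.
Proof.
rewrite beta_int_1 /ucoef.
have := @bin_fact (m.+1 + j) j (leq_addl _ _).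
rewrite addnK factS addSn [(j + m)%N]addnC.
have : (m + j).+1`!%:R != 0 :> R by rewrite pnatr_eq0 -lt0n fact_gt0.
move: ((m + j).+1)`! => F F0 EF; move: F0; rewrite -EF !natrM => F0.
rewrite -[RHS](divff F0); ring.
Qed.

Lemma u_beta_int m j f M : bounded_by f M -> u m.+1 j.+1 f = ucoef m j * beta_int j m f.
Proof.
move=> fM; rewrite /u /ucoef -mulrA; congr (_ * _).
rewrite /beta_int -RintegralZl//; last exact: integrable_J fM.
apply: eq_Rintegral => x; rewrite inE/= in_itv/= => /andP[x0 x1].
have y0 : 1 - x != 0 by rewrite subr_eq0 gt_eqF.
by rewrite /P !exprS; field.
Qed.

Lemma uD m k f g M A : bounded_by f M -> bounded_by g A ->
  u m.+1 k (fun t => f t + g t) = u m.+1 k f + u m.+1 k g.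
Proof.
case: k => // k fM gA.
by rewrite (u_beta_int _ _ (bounded_byD fM gA)) (u_beta_int _ _ fM) (u_beta_int _ _ gA) (beta_intD _ _ fM gA) mulrDr.
Qed.

Lemma uZ m k f M (c : R) : bounded_by f M -> u m.+1 k (fun t => c * f t) = c * u m.+1 k f.
Proof.
case: k => // k fM.
by rewrite (u_beta_int _ _ (bounded_byZ c fM)) (u_beta_int _ _ fM) (beta_intZ _ _ _ fM) mulrCA.
Qed.

Lemma u_cst m k (c : R) : u m.+1 k (cst c) = c.
Proof.
have b1 : bounded_by (cst (1 : R)) 1 by apply: bounded_by_cst; rewrite normr1.
have -> : cst c = (fun t : R => c * cst 1 t) by apply/funext => t; rewrite /= mulr1.
rewrite (uZ _ _ _ b1); case: k => [|k]; first by rewrite /= mulr1.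
by rewrite (u_beta_int _ _ b1) ucoef_J1 mulr1.
Qed.

Lemma u_ext n k f g : (forall x, 0 <= x < 1 -> f x = g x) -> u n k f = u n k g.
Proof.
move=> fg; case: k => [|k] /=; first by rewrite fg// lexx ltr01.
congr (_ * _); apply: eq_Rintegral => x; rewrite inE/= in_itv/= => /andP[x0 x1].
by rewrite fg// ltW.
Qed.

Lemma u_norm m k f M : bounded_by f M -> `|u m.+1 k f| <= M.
Proof.
move=> fM; case: k => [|k]; first by case: fM => _; apply; rewrite lexx ltr01.
rewrite (u_beta_int _ _ fM) normrM gtr0_norm ?ucoef_gt0//.
have := beta_int_norm k m fM; rewrite -(ler_pM2l (ucoef_gt0 m k)) => /le_trans; apply.
by rewrite mulrCA ucoef_J1 mulr1.
Qed.

Lemma u_rec m k f M : bounded_by f M -> m.+1%:R * u m.+2 k f =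
  (m.+1 + k)%:R * u m.+1 k f - k%:R * u m.+1 k.+1 f.
Proof.
move=> fM; case: k => [|k]; first by rewrite addn0 mul0r subr0.
rewrite !(u_beta_int _ _ fM) (beta_int_1x _ _ fM) [LHS]mulrA ucoef_up.
by rewrite [_ * (ucoef m k.+1 * _)]mulrA ucoef_ratio addSn addnS; ring.
Qed.

(** The bracket integrates f against the second derivative of t^(j+1) (1 - t)^(m+2), which is [phi]
    times the weight of [u]. This is the adjoint of D, to be matched with [beta_int_DtS]; the term
    in [f 0] plays the role of the boundary term. *)
Lemma Delta_u m j f M : bounded_by f M -> Delta m.+1 (u m.+1 ^~ f) j.+1 =
  ucoef m j * ((j.+1 * j)%:R * beta_int j.-1 m.+2 f - 2 * (j.+1 * m.+2)%:R * beta_int j m.+1 f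
    + (m.+1 * m.+2)%:R * beta_int j.+1 m f) + (j == 0%N)%:R * m.+1%:R * f 0.
Proof.
move=> fM; rewrite /Delta; case: j => [|i].
  rewrite !(u_beta_int _ _ fM) /= !(beta_int_1x _ _ fM).
  have := ucoef_ratio m 0; rewrite mul1r addn0 => ->.
  by rewrite !natrM !addn1 -!natr1; ring.
rewrite [i.+2.-1]/= !(u_beta_int _ _ fM) !(beta_int_1x _ _ fM) /= mul0r.
have E1 := ucoef_ratio m i; have E2 := ucoef_ratio m i.+1.
have i1 : i.+1%:R != 0 :> R by [].
have i2 : i.+2%:R != 0 :> R by [].
have -> : ucoef m i.+2 = (m + i.+1).+2%:R / i.+2%:R * ucoef m i.+1.
  by apply: (mulfI i2); rewrite E2; field.
have -> : ucoef m i.+1 = (m + i).+2%:R / i.+1%:R * ucoef m i.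
  by apply: (mulfI i1); rewrite E1; field.
rewrite !addnS !addSn !natrM -!natr1 !natrD in i1 i2 *.
by field; rewrite i1 i2.
Qed.

(** The mass of what the kernel in [Delta_u] lacks to be a square. Both summands have closed forms,
    each at most 2 (m + 1). *)
Lemma ucoef_beta_int_le m i : ucoef m i.+1 * (i.+2%:R * beta_int i m.+2 (cst 1)
   + m.+2%:R * beta_int i.+2 m (cst 1)) <= 4 * m.+1%:R.
Proof.
have b1 : bounded_by (cst (1 : R)) 1 by apply: bounded_by_cst; rewrite normr1.
rewrite !(beta_int_1x _ _ b1).
have E1 := ucoef_ratio m i; have E2 := ucoef_ratio m i.+1.
have W := ucoef_gt0 m; have W0 j : ucoef m j != 0 by rewrite gt_eqF.
have JE j : beta_int j m (cst 1) = (ucoef m j)^-1.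
  by apply: (mulfI (W0 j)); rewrite ucoef_J1 divff.
rewrite !JE.
have E1' : ucoef m i.+1 = (m + i).+2%:R / i.+1%:R * ucoef m i.
  by apply: (mulfI (_ : i.+1%:R != 0)) => //; rewrite E1; field.
have E2' : ucoef m i.+2 = (m + i).+3%:R / i.+2%:R * ucoef m i.+1.
  by apply: (mulfI (_ : i.+2%:R != 0)) => //; rewrite E2 addnS; field.
have -> : ucoef m i.+1 * (i.+2%:R * ((ucoef m i)^-1 - (ucoef m i.+1)^-1 - ((ucoef m i.+1)^-1
   - (ucoef m i.+2)^-1)) + m.+2%:R * (ucoef m i.+2)^-1) =
   i.+2%:R * m.+1%:R * m.+2%:R / (i.+1%:R * (m + i).+3%:R)
   + m.+2%:R * i.+2%:R / (m + i).+3%:R.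
  rewrite E2' E1'.
  have a1 : i.+1%:R != 0 :> R by [].
  have a2 : i.+2%:R != 0 :> R by [].
  have a3 : (m + i).+2%:R != 0 :> R by [].
  have a4 : (m + i).+3%:R != 0 :> R by [].
  move: a1 a2 a3 a4 (W0 i); rewrite -!natr1 natrD => a1 a2 a3 a4 a5.
  by field; rewrite a1 a2 a3 a4 a5.
have a4 : 0 < (m + i).+3%:R :> R by [].
have a1 : 0 < i.+1%:R :> R by [].
have -> : 4 * m.+1%:R = 2 * m.+1%:R + 2 * m.+1%:R :> R by ring.
rewrite lerD//.
  rewrite ler_pdivrMr ?mulr_gt0// -!natrM ler_nat; nia.
rewrite ler_pdivrMr// -!natrM ler_nat; nia.
Qed.

Lemma Delta_cstD n (a : nat -> R) (c : R) k :
  Delta n (fun k => c + a k) k = Delta n a k.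
Proof. by rewrite /Delta -natr1; ring. Qed.

Lemma DeltaN n (a : nat -> R) k : Delta n (fun k => - a k) k = - Delta n a k.
Proof. by rewrite /Delta; ring. Qed.

Lemma eq_Delta n (a b : nat -> R) k : (forall k, a k = b k) -> Delta n a k = Delta n b k.
Proof. by move=> /funext ->. Qed.

(* As for [has_sum_normQ]: the kernel of [Delta (u f)] is a square minus a
   positive part of mass at most [4 (m + 1)], so the bound from below follows by
   replacing [f] with the nonnegative function [M + f], which does not change
   [Delta (u f)]. *)
Lemma Delta_u_ge m k f M : bounded_by f M ->
  - (8 * m.+1%:R * M) <= Delta m.+1 (u m.+1 ^~ f) k.
Proof.
move=> fM; have M0 := bounded_by_ge0 fM.
have bM : bounded_by (cst M) M by apply: bounded_by_cst; rewrite ger0_norm.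
case: k => [|[|i]].
- by rewrite /Delta mul0r oppr_le0 !mulr_ge0.
(* Row 1 involves the point value [f 0], not an integral. Its entries have absolute sum 4 m + 8 <= 8
   (m + 1), which is enough. *)
- rewrite /Delta mul1r.
  have /ler_normlP[_ u2] := u_norm m 2 fM; have /ler_normlP[u2' _] := u_norm m 2 fM.
  have /ler_normlP[u1' u1] := u_norm m 1 fM.
  have /ler_normlP[u0' u0] := u_norm m 0 fM.
  rewrite addn1 [1.-1]/=.
  set U2 := u _ 2 _ in u2 u2' *; set U1 := u _ 1 _ in u1 u1' *.
  set U0 := u _ 0 _ in u0 u0' *.
  have m0 : 0 <= m%:R :> R by [].
  have p2 : 0 <= m%:R * (M + U2) by apply: mulr_ge0 => //; lra.
  have p1 : 0 <= m%:R * (M - U1) by apply: mulr_ge0 => //; lra.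
  have p0 : 0 <= m%:R * (M + U0) by apply: mulr_ge0 => //; lra.
  rewrite -!natr1; move: p0 p1 p2 m0 (mulr_ge0 m0 M0) ; lra.
pose g t := M + f t.
have bg : bounded_by g (M + M) by exact: bounded_byD.
have g0 x : 0 < x < 1 -> 0 <= g x.
  move=> /andP[x0 x1]; case: fM => _ /(_ x); rewrite ltW// x1 => /(_ isT).
  by move=> /ler_normlP[]; rewrite /g; lra.
have -> : Delta m.+1 (u m.+1 ^~ f) i.+2 = Delta m.+1 (u m.+1 ^~ g) i.+2.
  rewrite -(Delta_cstD _ _ M); apply: eq_Delta => k.
  by rewrite (uD _ _ bM fM) u_cst.
rewrite (Delta_u _ _ bg) mul0r mul0r addr0 [i.+1.-1]/=.
(* The square is completed by (i + 2) (i + 1) = (i + 2)^2 - (i + 2) and (m + 1) (m + 2) = (m + 2)^2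
   - (m + 2). *)
have sq := beta_int_sq i m i.+2%:R m.+2%:R bg g0.
have S1 := beta_int_le i m.+2 bg; have S2 := beta_int_le i.+2 m bg.
have Wi := ucoef_gt0 m i.+1.
have T := ucoef_beta_int_le m i.
set X := beta_int i m.+2 g in sq S1 *; set Y := beta_int i.+1 m.+1 g in sq *.
set Z := beta_int i.+2 m g in sq S2 *.
set X1 := beta_int i m.+2 (cst 1) in S1 T; set Z1 := beta_int i.+2 m (cst 1) in S2 T.
apply: (@le_trans _ _ (- (ucoef m i.+1 * (i.+2%:R * X + m.+2%:R * Z)))); last first.
  rewrite -mulrN ler_pM2l// !natrM -[i.+1%:R]addr0 -(subrr 1) addrA natr1.
  rewrite -[m.+1%:R]addr0 -(subrr 1) addrA natr1; move: sq; lra.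
rewrite lerN2; apply: (@le_trans _ _ ((M + M) *
   (ucoef m i.+1 * (i.+2%:R * X1 + m.+2%:R * Z1)))); last first.
  have -> : 8 * m.+1%:R * M = (M + M) * (4 * m.+1%:R) by ring.
  by rewrite ler_wpM2l// addr_ge0.
rewrite mulrCA ler_pM2l// mulrDr lerD// mulrCA ler_pM2l//.
Qed.

Lemma Delta_u_norm m k f M : bounded_by f M ->
  `|Delta m.+1 (u m.+1 ^~ f) k| <= 8 * m.+1%:R * M.
Proof.
move=> fM; rewrite ler_norml Delta_u_ge//=.
have bN : bounded_by (fun t => -1 * f t) M.
  by have := bounded_byZ (-1) fM; rewrite normrN1 mul1r.
have := Delta_u_ge m k bN.
rewrite (@eq_Delta _ _ (fun k => - u m.+1 k f)).
  by rewrite DeltaN lerN2.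
by move=> j; rewrite (uZ _ _ _ fM) mulN1r.
Qed.

End coefficients.

(** * Integration by parts *)

Section integration_by_parts.
Context {R : realType}.
Implicit Types (f g F : R -> R) (a : nat -> R) (l M A x : R) (n k m i j p q : nat).
Local Notation mu := (@lebesgue_measure R).
Local Notation oi := (`]0, 1[%classic : set R).

Lemma measurable_oi f : (forall x, 0 < x < 1 -> {for x, continuous f}) ->
  measurable_fun oi f.
Proof.
move=> h; apply: open_continuous_measurable_fun; first exact: interval_open.
by move=> x; rewrite inE/= in_itv/=; exact: h.
Qed.

Lemma is_derive_continuous f x d : is_derive x 1 f d -> {for x, continuous f}.
Proof. by move=> [h _]; apply: differentiable_continuous; exact/derivable1_diffP. Qed.

Lemma bounded_by_S n a M : (forall k, `|a k| <= M) -> bounded_by (Psum n a) M.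
Proof.
move=> aM; apply: (@bounded_by_ext _ (G0 n a)); first by move=> x; exact: S_G0.
split; last first.
  by move=> x x01; rewrite -(S_G0 n aM x01); have [] := has_sum_S n aM x01.
apply: measurable_oi => x /andP[x0 x1].
by apply: is_derive_continuous (is_derive_G0 n aM _); rewrite ltW.
Qed.

Lemma continuous_G2 n a M x : (forall k, `|a k| <= M) -> 0 <= x < 1 ->
  {for x, continuous (G2 n a)}.
Proof.
move=> aM x01; apply: differentiable_continuous.
by apply/derivable1_diffP; exact: derivable_G2 aM x01.
Qed.

Lemma bounded_by_DtS n a M : (forall k, `|a k| <= M) -> bounded_by (Dt (Psum n a)) (2 * n.+1%:R * M).
Proof.
move=> aM; split; last first.
  by move=> x x01; rewrite (Dt_S n aM)//; have [] := S_Delta n aM x01.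
apply: (@eq_measurable_fun _ _ _ _ oi (fun x => phi x * G2 n a x)).
  move=> x; rewrite inE/= in_itv/= => /andP[x0 x1].
  by rewrite (Dt_S_G2 n aM)// ltW.
apply: measurable_funM.
  by apply: measurable_funM => //; apply: measurable_funX; exact: measurable_funB.
apply: measurable_oi => x /andP[x0 x1].
by apply: continuous_G2 aM _; rewrite ltW.
Qed.

Lemma SB_norm n a M x : (forall k, `|a k| <= M) -> 0 <= x < 1 ->
  `|(1 - x) ^+ n.+1 * Bsum n a x| <= M.
Proof.
by move=> aM x01; rewrite -/(G0 n a x) -(S_G0 n aM)//; have [] := has_sum_S n aM x01.
Qed.

(** Multiplied by 1 - x, the derivative is a combination of bounded expansions with shifted
    coefficients. This and [G2_norm] control the behaviour at 1. *)
Lemma G1_norm n a M x : (forall k, `|a k| <= M) -> 0 <= x < 1 ->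
  `|(1 - x) * G1 n a x| <= 2 * n.+1%:R * M.
Proof.
move=> aM x01.
have h0 := SB_norm n aM x01; have h1 := SB_norm n.+1 (a := a \o succn) (fun k => aM k.+1) x01.
have -> : (1 - x) * G1 n a x = n.+1%:R * ((1 - x) ^+ n.+2 * Bsum n.+1 (a \o succn) x
   - (1 - x) ^+ n.+1 * Bsum n a x) by rewrite /G1 !exprS; ring.
rewrite normrM normr_nat -mulrA mulrCA ler_wpM2l//.
by apply: le_trans (ler_normB _ _) _; lra.
Qed.

Lemma G2_norm n a M x : (forall k, `|a k| <= M) -> 0 <= x < 1 ->
  `|(1 - x) ^+ 2 * G2 n a x| <= 4 * n.+1%:R * n.+2%:R * M.
Proof.
move=> aM x01.
have h0 := SB_norm n aM x01; have h1 := SB_norm n.+1 (a := a \o succn) (fun k => aM k.+1) x01.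
have h2 := SB_norm n.+2 (a := a \o succn \o succn) (fun k => aM k.+2) x01.
have -> : (1 - x) ^+ 2 * G2 n a x =
   n.+1%:R * (n.+2%:R * ((1 - x) ^+ n.+3 * Bsum n.+2 (a \o succn \o succn) x)
   - 2 * n.+1%:R * ((1 - x) ^+ n.+2 * Bsum n.+1 (a \o succn) x)
   + n%:R * ((1 - x) ^+ n.+1 * Bsum n a x)).
  by rewrite /G2; case: n {h0 h1 h2} => [|n]; rewrite !exprS; ring.
move: h0 h1 h2; set b0 := _ * Bsum n a x; set b1 := _ * Bsum n.+1 _ _.
set b2 := _ * Bsum n.+2 _ _ => h0 h1 h2.
have -> : 4 * n.+1%:R * n.+2%:R * M = n.+1%:R * (4 * n.+2%:R * M) by ring.
rewrite normrM normr_nat ler_wpM2l//.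
have H (c : nat) b : `|b| <= M -> `|c%:R * b| <= c%:R * M.
  by move=> bM; rewrite normrM normr_nat ler_wpM2l.
have /ler_normlP[A0 B0] := H n _ h0; have /ler_normlP[A1 B1] := H (2 * n.+1)%N _ h1.
have /ler_normlP[A2 B2] := H n.+2 _ h2.
rewrite natrM in A1 B1.
rewrite ler_norml; move: A0 B0 A1 B1 A2 B2 (ler0n R n).
have M0 : 0 <= M by apply: le_trans h0.
have := mulr_ge0 (ler0n R n) M0.
by rewrite -!natr1 => *; apply/andP; split; lra.
Qed.

(** The linear bounds make F and f extend continuously by 0 to the point 1, so the fundamental
    theorem applies on [0,1] and the boundary term at 1 vanishes. *)
Lemma FTC01 F f (C : R) : (forall x, 0 <= x < 1 -> is_derive x 1 F (f x)) ->
  (forall x, 0 <= x < 1 -> {for x, continuous f}) ->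
  (forall x, 0 <= x < 1 -> `|F x| <= C * (1 - x)) ->
  (forall x, 0 <= x < 1 -> `|f x| <= C * (1 - x)) ->
  \int[mu]_(t in oi) f t = - F 0.
Proof.
move=> dF cf FC fC.
(* The values of [F] and [f] at 1 are junk, hence the patch by 0. *)
pose p (h : R -> R) (x : R) := if x < 1 then h x else 0.
have pE h x : 0 < x < 1 -> \forall y \near x, h y = p h y.
  by move=> x01; apply: near01 => // y /andP[_ y1]; rewrite /p y1.
have pcvg h : (forall x, 0 <= x < 1 -> `|h x| <= C * (1 - x)) ->
    p h x @[x --> 1^'-] --> p h 1.
  move=> hC; rewrite [in X in _ --> X]/p ltxx.
  have C0 : 0 <= C by have := hC 0; rewrite lexx ltr01 subr0 mulr1 => /(_ isT); exact: le_trans.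
  have C1 : 0 < C + 1 by rewrite ltr_wpDl.
  apply/cvgrPdist_le => e e0; near=> x.
  have x0 : 0 < x by near: x; exact: nbhs_left_gt.
  have x1 : x < 1 by near: x; exact: nbhs_left_lt.
  rewrite sub0r normrN /p x1; apply: le_trans (hC x _) _; first by rewrite ltW.
  apply: le_trans (_ : (C + 1) * (1 - x) <= e).
    by rewrite ler_wpM2r ?subr_ge0 ?(ltW x1)// lerDl.
  rewrite mulrC -ler_pdivlMr//.
  rewrite lerBlDr -lerBlDl; apply: ltW; near: x; apply: nbhs_left_gt.
  by rewrite ltrBlDr ltrDl divr_gt0.
have p0 h : {for 0, continuous h} -> p h x @[x --> 0^'+] --> p h 0.
  move=> ch; rewrite [in X in _ --> X]/p ltr01.
  apply: cvg_trans (cvg_at_right_filter ch); apply: near_eq_cvg.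
  near=> x; rewrite /p; suff -> : x < 1 by [].
  by near: x; exact: nbhs_right_lt.
have x00 : 0 <= (0 : R) < 1 by rewrite lexx ltr01.
have := @continuous_FTC2 R (p f) (p F) 0 1 ltr01.
have cpf : {within `[0, 1], continuous (p f)}.
  apply/continuous_within_itvP => //; split; [|exact/p0/cf|exact: pcvg].
  move=> x; rewrite in_itv/= => x01; have /andP[x0 x1] := x01.
  rewrite /continuous_at -(nbhs_singleton (pE f x x01)).
  apply: cvg_trans (cf x _); last by rewrite ltW.
  by apply: near_eq_cvg; apply: filterS (pE f x x01).
move=> /(_ cpf) H.
transitivity (\int[mu]_(t in oi) p f t).
  apply: eq_Rintegral => x; rewrite inE/= in_itv/= => /andP[_ x1].
  by rewrite /p x1.
have mpf : measurable_fun oi (p f).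
  apply: measurable_oi => x x01; have := (continuous_within_itvP _ ltr01).1 cpf.
  by move=> [+ _ _]; apply; rewrite in_itv.
rewrite /Rintegral -[X in fine X](@integral_itv_bndoo R 0 1 _ true false); last first.
  exact/measurable_EFinP.
rewrite H; first by rewrite /= /p ltxx ltr01 sub0r.
- split; [|apply: p0; exact: is_derive_continuous (dF _ x00)|exact: pcvg].
  move=> x; rewrite in_itv/= => x01; have /andP[x0 x1] := x01.
  apply: near_eq_derivable (pE F x x01) _.
  by have := dF x; rewrite (ltW x0) x1 => /(_ isT) [].
- move=> x; rewrite in_itv/= => x01; have /andP[x0 x1] := x01.
  have h := dF x; rewrite (ltW x0) x1 in h.
  have {}h := h isT; rewrite derive1E -(near_eq_derive _ (pE F x x01)) /p x1.
  exact: derive_val.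
Unshelve. all: by end_near. Qed.

Definition mono p q x : R := x ^+ p * (1 - x) ^+ q.

Lemma is_derive_mono p q x :
  is_derive x 1 (mono p q) (p%:R * mono p.-1 q x - q%:R * mono p q.-1 x).
Proof.
have h := is_deriveM (is_deriveX p (is_derive_id x (1 : R))) (is_derive_onemX q x).
apply: (is_derive_ext h) => [y|]; first by rewrite /mono !fctE.
by rewrite /mono /GRing.scale/= !fctE; ring.
Qed.

Lemma mono_le p q x : 0 <= x < 1 -> `|mono p q.+1 x| <= 1 - x.
Proof.
move=> /andP[x0 x1]; have y0 : 0 <= 1 - x by rewrite subr_ge0 ltW.
rewrite /mono ger0_norm; last by rewrite mulr_ge0// exprn_ge0.
rewrite exprS mulrCA -[leRHS]mulr1 ler_wpM2l// mulr_ile1 ?exprn_ge0 ?exprn_ile1//; lra.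
Qed.

(** The weight times [phi] is w = t^(j+1) (1 - t)^(m+3), and both derivatives are moved onto w; the
    last term is w'(0) times the value at 0. The exponent m + 1 of the weight leaves the factor 1 -
    t that [FTC01] requires. *)
Lemma beta_int_DtS j m n a M : (forall k, `|a k| <= M) ->
  beta_int j m.+1 (Dt (Psum n a)) = (j.+1 * j)%:R * beta_int j.-1 m.+3 (Psum n a)
    - 2 * (j.+1 * m.+3)%:R * beta_int j m.+2 (Psum n a)
    + (m.+2 * m.+3)%:R * beta_int j.+1 m.+1 (Psum n a) + (j == 0%N)%:R * Psum n a 0.
Proof.
move=> aM; have M0 : 0 <= M by apply: le_trans (aM 0%N).
have bS := bounded_by_S n aM; have bD := bounded_by_DtS n aM.
set g := Psum n a in bS bD *.
pose f1 t := t ^+ j * (1 - t) ^+ m.+1 * Dt g t.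
pose f2 t := t ^+ j.-1 * (1 - t) ^+ m.+3 * g t.
pose f3 t := t ^+ j * (1 - t) ^+ m.+2 * g t.
pose f4 t := t ^+ j.+1 * (1 - t) ^+ m.+1 * g t.
have i1 : mu.-integrable oi (EFin \o f1) by exact: integrable_J bD.
have i2 : mu.-integrable oi (EFin \o (fun t => (j.+1 * j)%:R * f2 t)).
  by apply: (integrableZl _ _ (integrable_J _ _ bS)).
have i3 : mu.-integrable oi (EFin \o (fun t => 2 * (j.+1 * m.+3)%:R * f3 t)).
  by apply: (integrableZl _ _ (integrable_J _ _ bS)).
have i4 : mu.-integrable oi (EFin \o (fun t => (m.+2 * m.+3)%:R * f4 t)).
  by apply: (integrableZl _ _ (integrable_J _ _ bS)).
have i23 : mu.-integrable oi (EFin \o (fun t => (j.+1 * j)%:R * f2 t - 2 * (j.+1 * m.+3)%:R * f3 t)).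
  exact: (integrableB _ i2 i3).
have i234 : mu.-integrable oi (EFin \o (fun t => (j.+1 * j)%:R * f2 t
   - 2 * (j.+1 * m.+3)%:R * f3 t + (m.+2 * m.+3)%:R * f4 t)).
  exact: (integrableD _ i23 i4).
(* Both integrations by parts at once: w g' - w' g has derivative w g'' - w'' g. *)
pose F t := mono j.+1 m.+3 t * G1 n a t
  - (j.+1%:R * mono j m.+3 t - m.+3%:R * mono j.+1 m.+2 t) * G0 n a t.
pose f t := mono j m.+1 t * (phi t * G2 n a t) - ((j.+1 * j)%:R * mono j.-1 m.+3 t
  - 2 * (j.+1 * m.+3)%:R * mono j m.+2 t + (m.+2 * m.+3)%:R * mono j.+1 m.+1 t) * G0 n a t.
suff : \int[mu]_(t in oi) f t = - F 0.
  have -> : \int[mu]_(t in oi) f t = \int[mu]_(t in oi) (f1 t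
    - ((j.+1 * j)%:R * f2 t - 2 * (j.+1 * m.+3)%:R * f3 t
       + (m.+2 * m.+3)%:R * f4 t)).
    apply: eq_Rintegral => x; rewrite inE/= in_itv/= => /andP[x0 x1].
    have x01 : 0 <= x < 1 by rewrite ltW.
    rewrite /f /f1 /f2 /f3 /f4 /mono /g (Dt_S_G2 n aM)// -(S_G0 n aM)//; ring.
  rewrite RintegralB// RintegralD// RintegralB// !RintegralZl//; last 3 first.
  - exact: integrable_J bS.
  - exact: integrable_J bS.
  - exact: integrable_J bS.
  rewrite -/(beta_int j m.+1 (Dt g)) -/(beta_int j.-1 m.+3 g) -/(beta_int j m.+2 g) -/(beta_int j.+1 m.+1 g).
  have -> : - F 0 = (j == 0%N)%:R * g 0.
    rewrite /F -(S_G0 n aM) ?lexx ?ltr01// -/g /mono.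
    by case: (j) => [|i]; rewrite !(expr0, exprS, subr0, expr1n) /=; ring.
  by move=> <-; ring.
have Cf := @FTC01 F f (2 * n.+1%:R * M + (j.+1%:R + m.+3%:R) * M +
  ((j.+1 * j)%:R + 2 * (j.+1 * m.+3)%:R + (m.+2 * m.+3)%:R) * M).
have pos (c : nat) : 0 <= c%:R * M by rewrite mulr_ge0.
apply: Cf => x x01; have /andP[x0 x1] := x01.
- have d0 := is_derive_G0 n aM x01; have d1 := is_derive_G1 n aM x01.
  have h := is_deriveB (is_deriveM (is_derive_mono j.+1 m.+3 x) d1)
    (is_deriveM (is_deriveB (is_deriveZ j.+1%:R (is_derive_mono j m.+3 x))
    (is_deriveZ m.+3%:R (is_derive_mono j.+1 m.+2 x))) d0).
  apply: (is_derive_ext h) => // ; have sE (c y : R) : c *: y = c * y by [].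
  rewrite /f !fctE !sE /phi /mono !natrM.
  by case: (j) => [|i] /=; rewrite !exprS /GRing.scale/=; ring.
- have c0 := is_derive_continuous (is_derive_G0 n aM x01).
  have c2 : {for x, continuous (G2 n a)} by exact: continuous_G2 aM x01.
  have cv p q := is_derive_continuous (is_derive_mono p q x).
  have cvZ p q (c : R) : {for x, continuous (fun t => c * mono p q t)}.
    by apply: continuousM; [exact: cvg_cst|exact: cv].
  apply: continuousB; apply: continuousM => //.
    have -> : (fun t => phi t * G2 n a t) = (fun t : R => mono 1 2 t * G2 n a t).
      by apply/funext => t; rewrite /phi /mono expr1.
    by apply: continuousM => //; exact: cv.
  by apply: continuousD => //; apply: continuousB.
- have B0 : `|G0 n a x| <= M by exact: SB_norm.
  have B1 := G1_norm n aM x01.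
  have -> : F x = mono j.+1 m.+2 x * ((1 - x) * G1 n a x) -
    (j.+1%:R * mono j m.+3 x - m.+3%:R * mono j.+1 m.+2 x) * G0 n a x.
    by rewrite /F /mono !exprS; ring.
  apply: le_trans (ler_normB _ _) _.
  apply: le_trans (_ : (1 - x) * (2 * n.+1%:R * M) +
     ((j.+1%:R + m.+3%:R) * (1 - x)) * M <= _).
    rewrite lerD// normrM ler_pM// ?mono_le//.
    apply: le_trans (ler_normB _ _) _.
    by rewrite [leRHS]mulrDl lerD// normrM normr_nat ler_wpM2l// mono_le.
  have -> : (1 - x) * (2 * n.+1%:R * M) + (j.+1%:R + m.+3%:R) * (1 - x) * M =
    (2 * n.+1%:R * M + (j.+1%:R + m.+3%:R) * M) * (1 - x) by ring.
  rewrite ler_wpM2r ?subr_ge0 ?(ltW x1)// lerDl mulr_ge0//.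
- have B0 : `|G0 n a x| <= M by exact: SB_norm.
  have B2 : `|phi x * G2 n a x| <= 2 * n.+1%:R * M.
    by rewrite -(Dt_S_G2 n aM)//; case: bD => _; exact.
  apply: le_trans (ler_normB _ _) _.
  apply: le_trans (_ : (1 - x) * (2 * n.+1%:R * M) +
     (((j.+1 * j)%:R + 2 * (j.+1 * m.+3)%:R + (m.+2 * m.+3)%:R) * (1 - x)) * M <= _).
    rewrite lerD// normrM ler_pM// ?mono_le//.
    apply: le_trans (ler_normD _ _) _; rewrite [leRHS]mulrDl lerD//; last first.
      by rewrite normrM normr_nat ler_wpM2l// mono_le.
    apply: le_trans (ler_normB _ _) _; rewrite [leRHS]mulrDl lerD//.
      by rewrite normrM normr_nat ler_wpM2l// mono_le.
    by rewrite -natrM normrM normr_nat ler_wpM2l// mono_le.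
  set c := ((j.+1 * j)%:R + _ + _).
  have -> : (1 - x) * (2 * n.+1%:R * M) + c * (1 - x) * M =
    (2 * n.+1%:R * M + c * M) * (1 - x) by ring.
  by rewrite ler_wpM2r ?subr_ge0 ?(ltW x1)// lerD2r lerDl mulr_ge0.
Qed.

Lemma u_DtS m k n a M : (forall k, `|a k| <= M) ->
  u m.+2 k (Dt (Psum n a)) = Delta m.+2 (u m.+2 ^~ (Psum n a)) k.
Proof.
move=> aM; case: k => [|j]; first by rewrite /Delta mul0r /= Dt0.
rewrite (u_beta_int _ _ (bounded_by_DtS n aM)) (Delta_u _ _ (bounded_by_S n aM)) (beta_int_DtS _ _ _ aM).
rewrite mulrDr; congr (_ + _); case: j => [|j]; last by rewrite !mul0r mulr0.
by rewrite /ucoef addn0 bin0 !mul1r mulr1.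
Qed.

End integration_by_parts.

(** * The operators [Mt n] and their relations *)

Section operators.
Context {R : realType}.
Implicit Types (f g h : R -> R) (a b : nat -> R) (l M A x : R) (n k m i j p q : nat).

Lemma S_ext n a b x : (forall k, a k = b k) -> Psum n a x = Psum n b x.
Proof. by move=> /funext ->. Qed.

Lemma S_lin n a b M A (c : R) x : (forall k, `|a k| <= M) -> (forall k, `|b k| <= A) ->
  0 <= x < 1 -> Psum n (fun k => a k - c * b k) x = Psum n a x - c * Psum n b x.
Proof.
move=> aM bA x01; have [ha _] := has_sum_S n aM x01; have [hb _] := has_sum_S n bA x01.
by apply: S_unique; apply: has_sum_ext (has_sumB ha (has_sumZ c hb)) => k; ring.
Qed.

(** 1 from the averages [u], 8 from [Delta_u_norm] divided by n. *)
Lemma ut_norm m f M k : bounded_by f M -> `|ut m.+1 f k| <= 9 * M.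
Proof.
move=> fM; apply: le_trans (ler_normB _ _) _.
have -> : 9 * M = M + m.+1%:R^-1 * (8 * m.+1%:R * M) by field.
rewrite lerD ?u_norm// normrM ger0_norm ?invr_ge0// ler_wpM2l ?invr_ge0//.
exact: Delta_u_norm.
Qed.

Lemma Mt_S_ut m f M x : bounded_by f M -> 0 <= x < 1 ->
  Mt m.+1 f x = Psum m.+1 (ut m.+1 f) x.
Proof. by move=> fM x01; have [] := Mt_S (fun k => u_norm m k fM) x01. Qed.

Lemma bounded_by_Mt m f M : bounded_by f M -> bounded_by (Mt m.+1 f) (9 * M).
Proof.
move=> fM; apply: bounded_by_ext (bounded_by_S m.+1 (fun k => ut_norm m k fM)) => x x01.
exact: Mt_S_ut fM x01.
Qed.

Lemma Delta_lin n a b (c : R) k :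
  Delta n (fun k => a k - c * b k) k = Delta n a k - c * Delta n b k.
Proof. by rewrite /Delta; ring. Qed.

Lemma Delta_ut m f k : Delta m.+1 (ut m.+1 f) k = Delta m.+1 (u m.+1 ^~ f) k
  - m.+1%:R^-1 * Delta m.+1 (Delta m.+1 (u m.+1 ^~ f)) k.
Proof. exact: Delta_lin. Qed.

Lemma Dt_Mt_S m f M x : bounded_by f M -> 0 <= x < 1 ->
  Dt (Mt m.+1 f) x = Psum m.+1 (Delta m.+1 (ut m.+1 f)) x.
Proof.
move=> fM x01; rewrite -(Dt_S m.+1 (fun k => ut_norm m k fM) x01).
by apply: Dt_ext => // y y01; exact: Mt_S_ut fM y01.
Qed.

(** The inner [Delta] is bounded coefficientwise by [Delta_u_norm], the outer one only after
    summation, by [S_Delta]. With n = m + 1 this gives 8 n + 16 (n + 1) <= 40 n. *)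
Lemma bounded_by_Dt_Mt m f M : bounded_by f M -> bounded_by (Dt (Mt m.+1 f)) (40 * m.+1%:R * M).
Proof.
move=> fM; have M0 := bounded_by_ge0 fM.
have b0 := fun k => u_norm m k fM; have b1 := fun k => Delta_u_norm m k fM.
split.
  have [mS _] := bounded_by_DtS m.+1 (fun k => ut_norm m k fM).
  apply: eq_measurable_fun mS => x; rewrite inE/= in_itv/= => /andP[x0 x1].
  apply: Dt_ext; first by rewrite ltW.
  by move=> y y01; rewrite (Mt_S_ut _ fM).
move=> x x01; rewrite (Dt_Mt_S _ fM)//.
have [_ h0 _ _] := S_Delta m.+1 b0 x01.
have [_ h1 S1 _] := S_Delta m.+1 b1 x01.
have [_ S0] := has_sum_S m.+1 b1 x01.
rewrite (@S_unique _ _ _ _ (Psum m.+1 (Delta m.+1 (u m.+1 ^~ f)) x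
   - m.+1%:R^-1 * Psum m.+1 (Delta m.+1 (Delta m.+1 (u m.+1 ^~ f))) x)); last first.
  by apply: has_sum_ext (has_sumB h0 (has_sumZ m.+1%:R^-1 h1)) => k; rewrite Delta_ut; ring.
apply: le_trans (ler_normB _ _) _.
apply: le_trans (_ : 8 * m.+1%:R * M + m.+1%:R^-1 *
   (2 * m.+2%:R * (8 * m.+1%:R * M)) <= _).
  by rewrite lerD// normrM ger0_norm ?invr_ge0// ler_wpM2l ?invr_ge0.
have -> : m.+1%:R^-1 * (2 * m.+2%:R * (8 * m.+1%:R * M)) = 16 * m.+2%:R * M by field.
rewrite -mulrDl ler_wpM2r// -!natrM -natrD ler_nat; lia.
Qed.

Lemma Dt_Mt_commute m n g a M x : (forall k, `|a k| <= M) ->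
  (forall y, 0 <= y < 1 -> g y = Psum n a y) -> 0 <= x < 1 ->
  Dt (Mt m.+2 g) x = Mt m.+2 (Dt g) x.
Proof.
move=> aM gS x01.
have bg : bounded_by g M by apply: bounded_by_ext (bounded_by_S n aM).
have DgS y : 0 <= y < 1 -> Dt g y = Dt (Psum n a) y by move=> y01; exact: Dt_ext.
have bDg : bounded_by (Dt g) (2 * n.+1%:R * M) by apply: bounded_by_ext (bounded_by_DtS n aM).
rewrite (Dt_Mt_S _ bg)// (Mt_S_ut _ bDg)//; apply: S_ext => k.
have E j : u m.+2 j (Dt g) = Delta m.+2 (u m.+2 ^~ g) j.
  rewrite (u_ext _ _ DgS) (u_DtS _ _ _ aM).
  by apply: eq_Delta => i; apply: u_ext => y y01; rewrite gS.
by rewrite Delta_ut /ut E; congr (_ - _ * _); apply: eq_Delta => j; rewrite E.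
Qed.

(* The Goodman-Sharma operator M_n. *)
Definition MGS n f x := Psum n (u n ^~ f) x.

Lemma MGS_ext n f g x : (forall y, 0 <= y < 1 -> f y = g y) -> MGS n f x = MGS n g x.
Proof. by move=> fg; apply: S_ext => k; exact: u_ext. Qed.

Lemma MGS_norm m f M x : bounded_by f M -> 0 <= x < 1 -> `|MGS m.+1 f x| <= M.
Proof. by move=> fM x01; have [] := has_sum_S m.+1 (fun k => u_norm m k fM) x01. Qed.

(** For merely bounded f the difference is expressed through [Delta]; on expansions, [MGS_diff_Dt]
    turns it into D f. *)
Lemma MGS_diff m f M x : bounded_by f M -> 0 <= x < 1 ->
  MGS m.+1 f x - MGS m.+2 f x =
  (m.+1%:R * m.+2%:R)^-1 * Psum m.+1 (Delta m.+1 (u m.+1 ^~ f)) x.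
Proof.
move=> fM x01; have M0 := bounded_by_ge0 fM.
have b0 := fun k => u_norm m k fM; have b1 := fun k => u_norm m.+1 k fM.
have [_ hD _ _] := S_Delta m.+1 b0 x01.
have [h0 _] := has_sum_S m.+1 b0 x01; have [h1 _] := has_sum_S m.+2 b1 x01.
have [V hV] : exists l', has_sum (fun k => (m.+1 + k).+1%:R * u m.+2 k f * P m.+1 k x) l'.
  apply: (@has_sum_quad _ m.+1 (fun k => (m.+1 + k).+1%:R * u m.+2 k f) M) => // k.
  rewrite normrM normr_nat mulrC -[leLHS]mulr1.
  rewrite ler_pM ?mulr_ge0 ?ler1n//.
  exact: ler_pM.
have [W hW] : exists l', has_sum (fun k => k%:R * u m.+2 k.-1 f * P m.+1 k x) l'.
  apply: (@has_sum_quad _ m.+1 (fun k => k%:R * u m.+2 k.-1 f) M) => // k.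
  rewrite normrM normr_nat mulrC -[leLHS]mulr1.
  rewrite ler_pM ?mulr_ge0 ?ler1n//.
  apply: ler_pM => //.
  by rewrite ler_nat; lia.
have hW' := (@has_sum_shift0 _ (fun k => k%:R * u m.+2 k.-1 f * P m.+1 k x) W
  (ltac:(by rewrite /= !mul0r))).2 hW.
(* Return to the basis of index n = m + 1: by [PnS] and [PS], (n + 1) P_{n+1,k} = (n + k + 1)
   P_{n,k} - (k + 1) P_{n,k+1}. The functionals are lowered afterwards by [u_rec]. *)
have E1 : m.+2%:R * MGS m.+2 f x = V - W.
  apply: has_sum_unique (has_sumZ m.+2%:R h1) (has_sum_ext _ (has_sumB hV hW')) => k /=.
  apply/esym; rewrite [LHS]mulrCA -PnS.
  transitivity (u m.+2 k f * ((m.+1 + k).+1%:R * P m.+1 k x - (m.+1 + k).+1%:R * x * P m.+1 k x)).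
    by ring.
  by rewrite PS; ring.
have E2 : m.+1%:R * (V - W) = m.+1%:R * m.+2%:R * MGS m.+1 f x
   - Psum m.+1 (Delta m.+1 (u m.+1 ^~ f)) x.
  apply: has_sum_unique (has_sumZ m.+1%:R (has_sumB hV hW)) _.
  apply: has_sum_ext (has_sumB (has_sumZ (m.+1%:R * m.+2%:R) h0) hD) => k.
  transitivity (((m.+1 + k).+1%:R * (m.+1%:R * u m.+2 k f)
    - k%:R * (m.+1%:R * u m.+2 k.-1 f)) * P m.+1 k x); last by ring.
  rewrite !(u_rec _ _ fM); case: k => [|k].
    by rewrite /Delta !addn0 !mul0r; ring.
  rewrite /Delta [k.+1.-1]/= !addSn !addnS -!natr1 natrD; ring.
have -> : MGS m.+2 f x = m.+2%:R^-1 * (V - W) by rewrite -E1; field.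
have -> : V - W = m.+1%:R^-1 * (m.+1%:R * m.+2%:R * MGS m.+1 f x
   - Psum m.+1 (Delta m.+1 (u m.+1 ^~ f)) x) by rewrite -E2; field.
by field; rewrite !gt_eqF ?ltr_wpDr.
Qed.

Lemma MGS_diff_Dt m n g a M x : (forall k, `|a k| <= M) ->
  (forall y, 0 <= y < 1 -> g y = Psum n a y) -> 0 <= x < 1 ->
  MGS m.+2 g x - MGS m.+3 g x = (m.+2%:R * m.+3%:R)^-1 * MGS m.+2 (Dt g) x /\
  Mt m.+2 g x = MGS m.+2 g x - m.+2%:R^-1 * MGS m.+2 (Dt g) x.
Proof.
move=> aM gS x01.
have bg : bounded_by g M by apply: bounded_by_ext (bounded_by_S n aM).
have DgS y : 0 <= y < 1 -> Dt g y = Dt (Psum n a) y by move=> y01; exact: Dt_ext.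
have E : MGS m.+2 (Dt g) x = Psum m.+2 (Delta m.+2 (u m.+2 ^~ g)) x.
  apply: S_ext => k; rewrite (u_ext _ _ DgS) (u_DtS _ _ _ aM).
  by apply: eq_Delta => i; apply: u_ext => y y01; rewrite gS.
rewrite E; split; first exact: MGS_diff bg x01.
rewrite (Mt_S_ut _ bg)//.
exact: S_lin (fun k => u_norm m.+1 k bg) (fun k => Delta_u_norm m.+1 k bg) x01.
Qed.

(** * Positivity and moments of the functionals *)

Lemma u_ge0 m k f M : bounded_by f M -> (forall y, 0 <= y < 1 -> 0 <= f y) -> 0 <= u m.+1 k f.
Proof.
move=> fM f0; case: k => [|k]; first by rewrite /= f0// lexx ltr01.
rewrite (u_beta_int _ _ fM) mulr_ge0 ?(ltW (ucoef_gt0 _ _))//; apply: beta_int_ge0 => y /andP[y0 y1].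
by apply: f0; rewrite ltW.
Qed.

Lemma bounded_by_id : bounded_by (id : R -> R) 1.
Proof. by split=> // x /andP[x0 x1]; rewrite ger0_norm// ltW. Qed.

Lemma u_id m k : u m.+1 k id = k%:R / (m.+1 + k)%:R :> R.
Proof.
case: k => [|k]; first by rewrite /= mul0r.
have b1 : bounded_by (cst (1 : R)) 1 by apply: bounded_by_cst; rewrite normr1.
rewrite (u_beta_int _ _ bounded_by_id).
have -> : beta_int k m id = beta_int k.+1 m (cst (1 : R)).
  by rewrite beta_int_x; apply: beta_int_ext => x _; rewrite mulr1.
have := ucoef_J1 m k.+1 : _ = 1 :> R; have := ucoef_ratio m k : _ = _ :> R.
rewrite addSn addnS => E J1; apply: (mulfI (_ : (m + k).+2%:R != 0)) => //.
by rewrite mulrA -E -mulrA J1 mulrCA divff.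
Qed.

Lemma u_sqr m k : u m.+1 k (fun t => t ^+ 2) =
  k%:R * k.+1%:R / ((m.+1 + k)%:R * (m.+1 + k).+1%:R) :> R.
Proof.
case: k => [|k]; first by rewrite /= expr0n /= !mul0r.
have b1 : bounded_by (cst (1 : R)) 1 by apply: bounded_by_cst; rewrite normr1.
have b2 : bounded_by (fun t : R => t ^+ 2) 1.
  apply: bounded_by_ext (bounded_by_mono 2 0 b1) => x _ /=; by rewrite expr0 !mulr1.
rewrite (u_beta_int _ _ b2).
have -> : beta_int k m (fun t : R => t ^+ 2) = beta_int k.+2 m (cst (1 : R)).
  by rewrite !beta_int_x; apply: beta_int_ext => x _; rewrite mulr1 expr2.
have J1 := ucoef_J1 m k.+2 : _ = 1 :> R.
have E1 := ucoef_ratio m k : _ = _ :> R; have E2 := ucoef_ratio m k.+1 : _ = _ :> R.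
rewrite addSn addnS in E2 *.
have n1 : (m + k).+2%:R != 0 :> R by [].
have n2 : (m + k).+3%:R != 0 :> R by [].
apply: (mulfI n1); apply: (mulfI n2).
transitivity ((m + k).+3%:R * ((m + k).+2%:R * ucoef m k) * beta_int k.+2 m (cst (1 : R))).
  by ring.
rewrite -E1.
transitivity (k.+1%:R * ((m + k).+3%:R * ucoef m k.+1) * beta_int k.+2 m (cst (1 : R))).
  by ring.
rewrite -E2.
transitivity (k.+1%:R * k.+2%:R * (ucoef m k.+2 * beta_int k.+2 m (cst (1 : R)))); first by ring.
rewrite J1; move: n1 n2; move: ((m + k).+2%:R : R) ((m + k).+3%:R : R) => z1 z2 n1 n2.
by field; rewrite n1 n2.
Qed.

End operators.

(** * Convergence and the Voronovskaya inequality *)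

Section voronovskaya.
Context {R : realType}.
Implicit Types (f g h : R -> R) (a b r Q : nat -> R) (l M A E e c x : R) (n k m i j p q : nat).

Lemma has_sum_P_id m x : 0 <= x < 1 ->
  has_sum (fun k => k%:R / (m.+1 + k)%:R * P m.+1 k x) x.
Proof.
move=> x01; apply/(@has_sum_shift0 _ (fun k => k%:R / (m.+1 + k)%:R * P m.+1 k x)).
  by rewrite !mul0r.
rewrite -[X in has_sum _ X]mulr1; apply: has_sum_ext (has_sumZ x (has_sum_P m.+1 x01)) => k.
rewrite addnS.
transitivity ((m.+1 + k).+1%:R^-1 * (k.+1%:R * P m.+1 k.+1 x)); last by ring.
by rewrite -PS -mulrA mulKf.
Qed.

Lemma has_sum_P_sqr m x : 0 <= x < 1 ->
  has_sum (fun k => k%:R * (k%:R - 1) / ((m.+1 + k)%:R * (m + k)%:R) * P m.+1 k x) (x ^+ 2).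
Proof.
move=> x01; pose s k := k%:R * (k%:R - 1) / ((m.+1 + k)%:R * (m + k)%:R) * P m.+1 k x.
apply/(@has_sum_shift0 _ s); first by rewrite /s !mul0r.
apply/(@has_sum_shift0 _ (fun k => s k.+1)); first by rewrite /s subrr mulr0 !mul0r.
rewrite -[X in has_sum _ X]mulr1; apply: has_sum_ext (has_sumZ (x ^+ 2) (has_sum_P m.+1 x01)) => k.
have E1 := PS m.+1 k x; have E2 := PS m.+1 k.+1 x.
rewrite /s !addnS !addSn in E1 E2 *.
transitivity (((m + k).+3%:R * (m + k).+2%:R)^-1 * (k.+2%:R - 1)
   * (k.+2%:R * P m.+1 k.+2 x)); last by ring.
rewrite -E2 -[k.+2%:R]natr1 addrK.
transitivity (((m + k).+3%:R * (m + k).+2%:R)^-1 * (m + k).+3%:R * x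
   * (k.+1%:R * P m.+1 k.+1 x)); last by ring.
rewrite -E1.
have n1 : (m + k).+2%:R != 0 :> R by [].
have n2 : (m + k).+3%:R != 0 :> R by [].
move: n1 n2; move: ((m + k).+2%:R : R) ((m + k).+3%:R : R) => z1 z2 n1 n2.
by field; rewrite n1 n2.
Qed.

(** The second moment is replaced by the quantity that [has_sum_P_sqr] sums exactly to x^2, at the
    cost of 2 / n with n = m + 1. *)
Lemma u_sqr_le m k : u m.+1 k (fun t => t ^+ 2) <=
  k%:R * (k%:R - 1) / ((m.+1 + k)%:R * (m + k)%:R) + 2 / m.+1%:R :> R.
Proof.
rewrite u_sqr; case: k => [|k]; first by rewrite !mul0r add0r divr_ge0.
have m0 := ler0n R m; have k0 := ler0n R k.
have -> : (m.+1 + k.+1)%:R = m%:R + k%:R + 2 :> R.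
  by rewrite addSn addnS -!natr1 natrD; ring.
have -> : (m.+1 + k.+1).+1%:R = m%:R + k%:R + 3 :> R.
  by rewrite addSn addnS -!natr1 natrD; ring.
have -> : (m + k.+1)%:R = m%:R + k%:R + 1 :> R.
  by rewrite addnS -!natr1 natrD; ring.
rewrite -[k.+2%:R]natr1 -[k.+1%:R]natr1 -[m.+1%:R]natr1.
move: m0 k0; move: (m%:R : R) (k%:R : R) => y z y0 z0.
have p1 : 0 < y + z + 1 by rewrite ltr_wpDl ?addr_ge0.
have p2 : 0 < y + z + 2 by rewrite ltr_wpDl ?addr_ge0.
have p3 : 0 < y + z + 3 by rewrite ltr_wpDl ?addr_ge0.
have p4 : 0 < y + 1 by rewrite ltr_wpDl.
rewrite -lerBlDl.
have -> : (z + 1) * (z + 1 + 1) / ((y + z + 2) * (y + z + 3))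
    - (z + 1) * (z + 1 - 1) / ((y + z + 2) * (y + z + 1)) =
    2 * ((z + 1) * (y + 1)) / ((y + z + 1) * (y + z + 2) * (y + z + 3)).
  by field; rewrite !gt_eqF.
rewrite ler_pdivrMr ?mulr_gt0// -[leRHS]mulrA ler_wpM2l// [leRHS]mulrC ler_pdivlMr//.
have A1 : (y + 1) * (y + 1) <= (y + z + 1) * (y + z + 3).
  by apply: ler_pM; lra.
have A2 : (z + 1) * ((y + 1) * (y + 1)) <= (y + z + 2) * ((y + z + 1) * (y + z + 3)).
  by apply: ler_pM => //; [lra|apply: mulr_ge0; lra|lra].
by apply: le_trans (le_trans _ A2) _; rewrite le_eqVlt; apply/orP; left; apply/eqP; ring.
Qed.

Lemma bounded_by_X2 : bounded_by (fun t : R => t ^+ 2) 1.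
Proof.
have b1 : bounded_by (cst (1 : R)) 1 by apply: bounded_by_cst; rewrite normr1.
by apply: bounded_by_ext (bounded_by_mono 2 0 b1) => x _ /=; rewrite expr0 !mulr1.
Qed.

(** Korovkin's argument: positivity of [u] transfers the quadratic majorant to the coefficients, and
    since M_n reproduces 1 and t, its second moment about x is at most 2 / n. *)
Lemma MGS_dist m h M e c x : bounded_by h M -> 0 <= x < 1 -> 0 <= c ->
  (forall t, 0 <= t < 1 -> `|h t - h x| <= e + c * (t - x) ^+ 2) ->
  `|MGS m.+1 h x - h x| <= e + c * (2 / m.+1%:R).
Proof.
move=> hM x01 c0 hd.
pose q k := e + c * (u m.+1 k (fun t => t ^+ 2) - 2 * x * u m.+1 k id + x ^+ 2).
have uq k : `|u m.+1 k h - h x| <= q k.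
  have bq := bounded_byZ c (bounded_byD (bounded_byD bounded_by_X2 (bounded_byZ (- (2 * x)) (@bounded_by_id R)))
     (bounded_by_cst (lexx `|x ^+ 2|))).
  have bqe := bounded_byD (bounded_by_cst (lexx `|e|)) bq.
  have bqe' := bounded_byD bqe (bounded_by_cst (lexx `|h x|)).
  have bqe2 := bounded_byD bqe (bounded_by_cst (lexx `|- h x|)).
  have bNh := bounded_byZ (-1) hM.
  have g1 := @u_ge0 R m k _ _ (bounded_byD bqe' bNh).
  have g2 := @u_ge0 R m k _ _ (bounded_byD bqe2 hM).
  rewrite (uD _ _ bqe' bNh) (uD _ _ bqe (bounded_by_cst (lexx `|h x|))) in g1.
  rewrite (uD _ _ bqe2 hM) (uD _ _ bqe (bounded_by_cst (lexx `|- h x|))) in g2.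
  rewrite (uD _ _ (bounded_by_cst (lexx `|e|)) bq) (uZ _ _ _ (bounded_byD (bounded_byD bounded_by_X2 (bounded_byZ (- (2 * x)) (@bounded_by_id R)))
     (bounded_by_cst (lexx `|x ^+ 2|)))) (uD _ _ (bounded_byD bounded_by_X2 (bounded_byZ (- (2 * x)) (@bounded_by_id R)))
     (bounded_by_cst (lexx `|x ^+ 2|))) (uD _ _ bounded_by_X2 (bounded_byZ (- (2 * x)) (@bounded_by_id R)))
     (uZ _ _ _ (@bounded_by_id R)) !u_cst in g1 g2.
  rewrite (uZ _ _ _ hM) in g1.
  rewrite ler_norml; apply/andP; split.
    have : 0 <= q k + - h x + u m.+1 k h.
      rewrite /q -mulNr; apply: g2 => t t01 /=.
      have /ler_normlP[h1 _] := hd t t01; move: h1.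
      have -> : t ^+ 2 + - (2 * x) * t + x ^+ 2 = (t - x) ^+ 2 by ring.
      lra.
    lra.
  have : 0 <= q k + h x + -1 * u m.+1 k h.
    rewrite /q -mulNr; apply: g1 => t t01 /=.
    have /ler_normlP[_ h1] := hd t t01; move: h1.
    have -> : t ^+ 2 + - (2 * x) * t + x ^+ 2 = (t - x) ^+ 2 by ring.
    lra.
  lra.
have [hB _] := has_sum_S m.+1 (fun k => u_norm m k hM) x01.
have h1 := has_sum_P m.+1 x01.
have hup := has_sumB hB (has_sumZ (h x) h1).
have hq' := has_sumD (has_sumZ e h1) (has_sumZ c (has_sumD (has_sumB (has_sumD (has_sum_P_sqr m x01)
   (has_sumZ (2 / m.+1%:R) h1)) (has_sumZ (2 * x) (has_sum_P_id m x01))) (has_sumZ (x ^+ 2) h1))).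
have P0 k : 0 <= P m.+1 k x by case/andP: x01 => x0 /ltW x1; exact: P_ge0.
have dom k : `|u m.+1 k h * P m.+1 k x - h x * P m.+1 k x| <=
   e * P m.+1 k x + c * (k%:R * (k%:R - 1) / ((m.+1 + k)%:R * (m + k)%:R) * P m.+1 k x
   + 2 / m.+1%:R * P m.+1 k x - 2 * x * (k%:R / (m.+1 + k)%:R * P m.+1 k x)
   + x ^+ 2 * P m.+1 k x).
  rewrite -mulrBl normrM (ger0_norm (P0 k)).
  apply: le_trans (ler_wpM2r (P0 k) (uq k)) _.
  rewrite /q u_id.
  have := ler_wpM2l c0 (ler_wpM2r (P0 k) (u_sqr_le m k)).
  rewrite mulrDl -subr_ge0 => H2; rewrite -subr_ge0; apply: le_trans H2 _.
  by rewrite le_eqVlt; apply/orP; left; apply/eqP; ring.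
have [l' hl' lb] := has_sum_dominated dom hq'.
have <- : l' = MGS m.+1 h x - h x.
  by apply: has_sum_unique hl' _; have := hup; rewrite mulr1.
apply: le_trans lb _; rewrite !mulr1 le_eqVlt; apply/orP; left; apply/eqP; ring.
Qed.

End voronovskaya.

(** * Telescoping along the operators M_n *)

Section voronovskaya_limit.
Context {R : realType}.
Implicit Types (f g h : R -> R) (a b r Q : nat -> R) (l M A E e c x : R) (n k m i j p q : nat).

Lemma cvg_inv_shift (c : R) : (c / k.+2%:R) @[k --> \oo] --> (0 : R).
Proof.
rewrite -[X in _ --> X](mulr0 c); apply: cvgMl_tmp.
by have := @cvg_harmonic R; rewrite -cvg_shiftS.
Qed.

Lemma cvg_inv_shift2 (c : R) : (c / (k.+2%:R * k.+3%:R)) @[k --> \oo] --> (0 : R).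
Proof.
have -> : (fun k => c / (k.+2%:R * k.+3%:R)) = (fun k => c / k.+2%:R * (1 / k.+3%:R)).
  by apply/funext => k; rewrite invfM mul1r mulrA.
rewrite -[X in _ --> X](mulr0 0); apply: cvgM; first exact: cvg_inv_shift.
by have := cvg_inv_shift 1; rewrite -cvg_shiftS.
Qed.

(** Q + r is nondecreasing from p on. Comparison with an explicit r replaces the summation of
    tails. *)
Lemma telescope_le r Q p (rl Ql : R) :
  (forall k, (p <= k)%N -> r k - r k.+1 <= Q k.+1 - Q k) ->
  Q @ \oo --> Ql -> r @ \oo --> rl -> r p - rl <= Ql - Q p.
Proof.
move=> rQ cQ cr.
have mono k : (p <= k)%N -> Q p + r p <= Q k + r k.
  elim: k => [|k IH]; first by rewrite leqn0 => /eqP ->.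
  rewrite leq_eqVlt => /predU1P[-> //|]; rewrite ltnS => pk.
  by apply: le_trans (IH pk) _; have := rQ k pk; lra.
have : Q p + r p <= Ql + rl.
  have cQr : (fun k => Q k + r k) @ \oo --> Ql + rl by exact: cvgD.
  apply: (cvgr_to_ge cQr).
  by exists p => // k /= pk; exact: mono.
lra.
Qed.

Lemma MGS_cvg h M x : bounded_by h M -> 0 <= x < 1 ->
  (forall e, 0 < e -> exists2 d, 0 < d &
    forall t, 0 <= t < 1 -> `|t - x| < d -> `|h t - h x| <= e) ->
  MGS k.+2 h x @[k --> \oo] --> h x.
Proof.
move=> hM x01 hc; have M0 := bounded_by_ge0 hM.
apply/cvgrPdistC_le => e e0.
have e2 : 0 < e / 2 by rewrite divr_gt0.
have [d d0 hd] := hc _ e2.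
have dd : 0 < d ^+ 2 by rewrite exprn_gt0.
(* Where |t - x| >= d, the trivial bound 2 M is at most c (t - x)^2. *)
pose c := 2 * M / d ^+ 2.
have c0 : 0 <= c by rewrite /c divr_ge0 ?mulr_ge0// ltW.
have H t : 0 <= t < 1 -> `|h t - h x| <= e / 2 + c * (t - x) ^+ 2.
  move=> t01; have [tx|tx] := ltP `|t - x| d.
    by apply: le_trans (hd t t01 tx) _; rewrite lerDl mulr_ge0 ?sqr_ge0.
  apply: le_trans (_ : 2 * M <= _).
    case: hM => _ hM; apply: le_trans (ler_normB _ _) _.
    by rewrite mulrC mulr_natr mulr2n lerD// hM.
  suff : 2 * M <= c * (t - x) ^+ 2.
    by move=> /le_trans; apply; rewrite lerDr ltW.
  rewrite /c mulrAC ler_pdivlMr// ler_wpM2l ?mulr_ge0//.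
  by rewrite -[leRHS]real_normK ?num_real// lerXn2r// nnegrE ltW.
near=> k.
apply: le_trans (MGS_dist k.+1 hM x01 c0 H) _.
rewrite [leRHS](splitr e) lerD2l mulrA; near: k.
by have := cvg_inv_shift (c * 2); move=> /cvgr_le; apply.
Unshelve. all: by end_near. Qed.

Lemma S_continuous n a M x : (forall k, `|a k| <= M) -> 0 <= x < 1 ->
  forall e, 0 < e -> exists2 d, 0 < d &
    forall t, 0 <= t < 1 -> `|t - x| < d -> `|Psum n a t - Psum n a x| <= e.
Proof.
move=> aM x01 e e0.
have cG : {for x, continuous (G0 n a)}.
  exact: is_derive_continuous (is_derive_G0 n aM x01).
have /cvgrPdistC_le /(_ e e0) [d d0 hd] := cG.
exists d => // t t01 tx; rewrite (S_G0 n aM t01) (S_G0 n aM x01).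
by apply: hd; rewrite /= distrC.
Qed.

Lemma MGS_cvg_S h n a M x : (forall k, `|a k| <= M) ->
  (forall y, 0 <= y < 1 -> h y = Psum n a y) -> 0 <= x < 1 ->
  MGS k.+2 h x @[k --> \oo] --> h x.
Proof.
move=> aM hS x01; apply: (MGS_cvg (M := M)) => //.
  by apply: bounded_by_ext (bounded_by_S n aM).
move=> e e0; have [d d0 hd] := S_continuous n aM x01 e0.
by exists d => // t t01 tx; rewrite (hS t t01) (hS x x01); exact: hd.
Qed.

(** M_k h - M_{k+1} h = M_k (D h) / (k (k + 1)) is at most the decrement of E / k in absolute value,
    and M_k h tends to h. *)
Lemma MGS_Dt_le h n a M E p x : (forall k, `|a k| <= M) ->
  (forall y, 0 <= y < 1 -> h y = Psum n a y) -> bounded_by (Dt h) E -> 0 <= x < 1 ->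
  `|MGS p.+2 h x - h x| <= E / p.+2%:R.
Proof.
move=> aM hS hE x01; have cA := MGS_cvg_S aM hS x01.
have dA k : MGS k.+2 h x - MGS k.+3 h x = (k.+2%:R * k.+3%:R)^-1 * MGS k.+2 (Dt h) x.
  by have [] := MGS_diff_Dt k aM hS x01.
have cE := cvg_inv_shift (- E).
have cNA : (fun k => - MGS k.+2 h x) @ \oo --> - h x by exact: cvgN.
have rE k : - E / k.+2%:R - - E / k.+3%:R = - (E * (k.+2%:R * k.+3%:R)^-1) :> R.
  rewrite -[k.+3%:R]natr1; have : 0 < k.+2%:R :> R by [].
  by move: (k.+2%:R : R) => z z0; field; rewrite !gt_eqF ?addr_gt0.
have bk k : `|MGS k.+2 (Dt h) x| <= E by exact: MGS_norm.
have i0 k : 0 <= (k.+2%:R * k.+3%:R)^-1 :> R by [].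
have s1 : forall k, (p <= k)%N ->
    - E / k.+2%:R - - E / k.+3%:R <= MGS k.+3 h x - MGS k.+2 h x.
  move=> k _; rewrite rE -[leRHS]opprB dA lerN2 [leLHS]mulrC ler_wpM2r//.
  by have /ler_normlP[] := bk k.
have s2 : forall k, (p <= k)%N ->
    - E / k.+2%:R - - E / k.+3%:R <= - MGS k.+3 h x - - MGS k.+2 h x.
  move=> k _; rewrite rE opprK [leRHS]addrC dA -mulNr [leRHS]mulrC ler_wpM2r//.
  by have /ler_normlP[? ?] := bk k; lra.
have t1 := @telescope_le (fun k => - E / k.+2%:R) (fun k => MGS k.+2 h x) p _ _ s1 cA cE.
have t2 := @telescope_le (fun k => - E / k.+2%:R) (fun k => - MGS k.+2 h x) p _ _ s2 cNA cE.
move: t1 t2; rewrite /= !subr0 !mulNr.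
move: (E / _) (MGS _ h x) (h x) => z y0 y1 t1 t2.
by rewrite ler_norml; apply/andP; split; lra.
Qed.

(** From index p on, M_k (D^2 h) stays within e = E / (p + 2) of D^2 h at x. If |D^2 h(x)| exceeds e
    by t, all later increments of [Mt k h x] have the same sign and a size governed by t; nothing
    cancels, and [Mt p.+2 h x] is far from its limit h(x). *)
Lemma voronovskaya_le h h1 h2 n a a1 a2 M M1 M2 E p x :
  (forall k, `|a k| <= M) -> (forall k, `|a1 k| <= M1) -> (forall k, `|a2 k| <= M2) ->
  (forall y, 0 <= y < 1 -> h y = Psum n a y) ->
  (forall y, 0 <= y < 1 -> h1 y = Psum n a1 y) ->
  (forall y, 0 <= y < 1 -> h2 y = Psum n a2 y) ->
  (forall y, 0 <= y < 1 -> Dt h y = h1 y) ->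
  (forall y, 0 <= y < 1 -> Dt h1 y = h2 y) ->
  bounded_by (Dt h2) E -> 0 <= x < 1 ->
  `|h2 x| <= E / p.+2%:R + 2 * (p.+2%:R * p.+3%:R) * `|Mt p.+2 h x - h x|.
Proof.
move=> aM a1M a2M hS h1S h2S Dh Dh1 hE x01.
have E0 := bounded_by_ge0 hE.
pose A k := MGS k.+2 h x; pose D k := MGS k.+2 h1 x; pose C k := MGS k.+2 h2 x.
pose Q k := A k - k.+2%:R^-1 * D k.
have dA k : A k - A k.+1 = (k.+2%:R * k.+3%:R)^-1 * D k.
  by have [-> _] := MGS_diff_Dt k aM hS x01; congr (_ * _); exact: MGS_ext.
have QM k : Mt k.+2 h x = Q k.
  have [_ ->] := MGS_diff_Dt k aM hS x01; congr (_ - _ * _); exact: MGS_ext.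
have dB k : D k - D k.+1 = (k.+2%:R * k.+3%:R)^-1 * C k.
  by have [-> _] := MGS_diff_Dt k a1M h1S x01; congr (_ * _); exact: MGS_ext.
have dQ k : Q k.+1 - Q k = (k.+2%:R * k.+3%:R ^+ 2)^-1 * C k.
  have -> : Q k.+1 - Q k = - (A k - A k.+1) + k.+2%:R^-1 * D k - k.+3%:R^-1 * D k.+1.
    by rewrite /Q; ring.
  have -> : D k.+1 = D k - (k.+2%:R * k.+3%:R)^-1 * C k by rewrite -dB; ring.
  rewrite dA -[k.+3%:R]natr1; have : 0 < k.+2%:R :> R by [].
  by move: (k.+2%:R : R) => z z0; field; rewrite !gt_eqF ?addr_gt0.
have cQ : Q @ \oo --> h x.
  rewrite -[X in _ --> X]subr0 -[X in _ - X](mul0r (h1 x)).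
  apply: cvgB; first exact: MGS_cvg_S aM hS x01.
  apply: cvgM; last exact: MGS_cvg_S a1M h1S x01.
  have := cvg_inv_shift 1; under eq_fun do rewrite mul1r; exact.
have [e Ee] : {e : R | e = E / p.+2%:R} by eexists.
have Ck k : (p <= k)%N -> `|C k - h2 x| <= e.
  rewrite Ee => pk; apply: le_trans (MGS_Dt_le k a2M h2S hE x01) _.
  by rewrite ler_wpM2l// lef_pV2 ?posrE// ler_nat.
rewrite -Ee QM.
(* both signs of [h2 x] are covered by taking [s = 1] and [s = -1] *)
have key (s : R) : `|s| = 1 -> s * h2 x <= e + 2 * (p.+2%:R * p.+3%:R) * `|Q p - h x|.
  move=> s1; have [|sp] := leP (s * h2 x - e) 0.
    rewrite subr_le0 => /le_trans; apply; rewrite lerDl.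
    by rewrite !mulr_ge0.
  pose t := s * h2 x - e.
  (* With j = k + 2, the decrement of t / (2 j (j + 1)) is t / (j (j + 1) (j + 2)), below the
     increment t / (j (j + 1)^2) that is available. *)
  have step k : (p <= k)%N -> t / 2 / (k.+2%:R * k.+3%:R) - t / 2 / (k.+3%:R * k.+4%:R)
      <= s * Q k.+1 - s * Q k.
    move=> pk; rewrite -[leRHS]mulrBr dQ.
    have tC : t <= s * C k.
      have := Ck k pk; rewrite -[`|C k - _|]mul1r -s1 -normrM mulrBr.
      by move=> /ler_normlP[+ _]; rewrite /t; lra.
    rewrite mulrCA; apply: le_trans (_ : (k.+2%:R * k.+3%:R ^+ 2)^-1 * t <= _).
      have -> : t / 2 / (k.+2%:R * k.+3%:R) - t / 2 / (k.+3%:R * k.+4%:R) =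
          (k.+2%:R * k.+3%:R * k.+4%:R)^-1 * t.
        rewrite -[k.+4%:R]natr1 -[k.+3%:R]natr1; have : 0 < k.+2%:R :> R by [].
        by move: (k.+2%:R : R) => z z0; field; rewrite !gt_eqF ?addr_gt0.
      rewrite ler_wpM2r ?(ltW sp)// lef_pV2 ?posrE// expr2 mulrA.
      by rewrite ler_wpM2l// ler_nat.
    by rewrite ler_wpM2l.
  have csQ : (fun k => s * Q k) @ \oo --> s * h x by exact: cvgMl_tmp.
  have := @telescope_le (fun k => t / 2 / (k.+2%:R * k.+3%:R)) (fun k => s * Q k) p 0
    (s * h x) step csQ (cvg_inv_shift2 _).
  rewrite subr0 -mulrBr => H.
  have : t / 2 / (p.+2%:R * p.+3%:R) <= `|Q p - h x|.
    by apply: le_trans H _; rewrite distrC -[leRHS]mul1r -s1 -normrM ler_norm.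
  rewrite ler_pdivrMr// /t; lra.
rewrite ler_norml; apply/andP; split.
  by have := key (-1); rewrite normrN1 => /(_ erefl); lra.
by have := key 1; rewrite normr1 => /(_ erefl); lra.
Qed.

End voronovskaya_limit.

(** * Membership in the function spaces *)

Section function_spaces.
Context {R : realType}.
Implicit Types (f g h : R -> R) (a : nat -> R) (M A c x s t : R) (n k m i : nat).
Local Notation mu := (@lebesgue_measure R).

Lemma unif_norm_le f M : (forall x, 0 <= x < 1 -> `|f x| <= M) ->
  (unif_norm f <= M%:E)%E.
Proof.
move=> fM; apply: ge_ereal_sup => y [x /=]; rewrite in_itv/= => x01 <-.
by rewrite lee_fin fM.
Qed.

Lemma le_unif_norm f x : 0 <= x < 1 -> (`|f x|%:E <= unif_norm f)%E.
Proof.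
by move=> x01; apply: ereal_sup_ubound; exists x => //=; rewrite in_itv.
Qed.

Lemma fine_unif_norm f M : (forall x, 0 <= x < 1 -> `|f x| <= M) ->
  (fine (unif_norm f))%:E = unif_norm f /\
  forall x, 0 <= x < 1 -> `|f x| <= fine (unif_norm f).
Proof.
move=> fM; have x00 : 0 <= (0 : R) < 1 by rewrite lexx ltr01.
have fin : unif_norm f \is a fin_num.
  apply: fin_real; apply/andP; split.
    exact: lt_le_trans (ltNyr _) (le_unif_norm _ x00).
  exact: le_lt_trans (unif_norm_le fM) (ltry _).
split; first by rewrite fineK.
by move=> x x01; rewrite -lee_fin fineK//; exact: le_unif_norm.
Qed.

Lemma ess_norm_le f M : 0 <= M -> (forall x, 0 <= x < 1 -> `|f x| <= M) ->
  (ess_norm f <= M%:E)%E.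
Proof.
move=> M0 fM; rewrite /ess_norm unlock; case: ifPn => _ //.
apply/ess_supP; apply: aeW => x /=; rewrite lee_fin patchE.
case: ifPn; last by rewrite normr0.
by rewrite inE/= in_itv/= => x01; exact: fM.
Qed.

Lemma Linfty_bounded_by f M : bounded_by f M -> Linfty f.
Proof.
move=> fM; split; last first.
  apply: (@le_lt_trans _ _ M%:E); last exact: ltry.
  by apply: ess_norm_le (bounded_by_ge0 fM) _; case: fM.
have [mf _] := fM => _ Y mY.
have mf' : measurable_fun (`[0, 1[%classic : set R) f.
  exact/measurable_fun_itv_obnd_cbndP.
have mA := mf' (measurable_itv _) Y mY; apply: sub_sigma_algebra.
exists (`[0, 1[%classic `&` f @^-1` Y) => //; exists set0; last by rewrite setU0.
exact: negligible_set0.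
Qed.

Lemma Lipschitz_abs_continuous f (a0 b0 : R) c : 0 <= c ->
  (forall s t, a0 <= s -> s <= t -> t <= b0 -> `|f t - f s| <= c * (t - s)) ->
  abs_continuous a0 b0 f.
Proof.
move=> c0 lip e e0; have c1 : 0 < c + 1 by rewrite ltr_wpDl.
exists (e / (c + 1)); first by rewrite divr_gt0.
move=> m s t st _ sumd.
apply: (@le_lt_trans _ _ (\sum_(i < m) c * (t i - s i))).
  by apply: ler_sum => i _; have [? ? ?] := st i; exact: lip.
rewrite -mulr_sumr; apply: (@le_lt_trans _ _ ((c + 1) * \sum_(i < m) (t i - s i))).
  rewrite ler_wpM2r ?lerDl//; apply: sumr_ge0 => i _.
  by rewrite subr_ge0; case: (st i).
by rewrite mulrC -ltr_pdivlMr.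
Qed.

(** By the mean value theorem f is Lipschitz on each [a,b]. The bound is asked on (0,b] since
    [G1_norm] and [G2_norm] degenerate at 1 only. *)
Lemma AC_loc_derive f (df : R -> R) :
  (forall x, 0 < x < 1 -> is_derive x 1 f (df x)) ->
  (forall b0 : R, b0 < 1 -> exists c, forall x, 0 < x <= b0 -> `|df x| <= c) -> AC_loc f.
Proof.
move=> fd dfb a0 b0 a00 ab b1; have [c hc] := dfb b0 b1.
have c0 : 0 <= c.
  by apply: le_trans (hc a0 _); rewrite ?normr_ge0// a00 ab.
apply: (@Lipschitz_abs_continuous _ _ _ c c0) => s t as_ st tb.
have d x : s <= x <= t -> is_derive x 1 f (df x).
  move=> /andP[sx xt]; apply: fd; rewrite (lt_le_trans a00 (le_trans as_ sx)).
  exact: le_lt_trans (le_trans xt tb) b1.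
have h1 x : x \in `]s, t[ -> is_derive x 1 f (df x).
  by rewrite in_itv/= => /andP[sx xt]; apply: d; rewrite !ltW.
have h2 : {within `[s, t], continuous f}.
  apply: continuous_in_subspaceT => x; rewrite inE/= in_itv/= => xst.
  exact: is_derive_continuous (d x xst).
have [z + ->] := MVT_segment st h1 h2.
rewrite in_itv/= => /andP[sz zt].
rewrite normrM [X in _ * X]ger0_norm ?subr_ge0// ler_wpM2r ?subr_ge0//.
by apply: hc; rewrite (lt_le_trans a00 (le_trans as_ sz)) (le_trans zt tb).
Qed.

Lemma W2_S g n a M : (forall k, `|a k| <= M) ->
  (forall x, 0 <= x < 1 -> g x = Psum n a x) -> W2 g.
Proof.
move=> aM gS; have M0 : 0 <= M by apply: le_trans (aM 0%N).
have gG x : 0 < x < 1 -> g x = G0 n a x.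
  by move=> /andP[x0 x1]; rewrite gS ?(S_G0 n aM)// ltW.
have dg x : 0 < x < 1 -> is_derive x 1 g (G1 n a x).
  move=> x01; have /andP[x0 x1] := x01.
  apply: near_eq_is_derive (is_derive_G0 n aM _); last by rewrite ltW.
  by apply: near01 => // y /gG.
have d1g x : 0 < x < 1 -> is_derive x 1 (derive1 g) (G2 n a x).
  move=> x01; have /andP[x0 x1] := x01.
  apply: near_eq_is_derive (is_derive_G1 n aM _); last by rewrite ltW.
  by apply: near01 => // y y01; rewrite derive1E; have h := dg y y01; rewrite derive_val.
split.
- apply: (AC_loc_derive dg) => b0 b1; exists (2 * n.+1%:R * M / (1 - b0)).
  move=> x /andP[x0 xb]; have x1 := le_lt_trans xb b1.
  rewrite ler_pdivlMr ?subr_gt0//; have := @G1_norm _ n a M x aM.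
  rewrite (ltW x0) x1 => /(_ isT); apply: le_trans.
  rewrite [leRHS]normrM [leRHS]mulrC ler_wpM2l// ger0_norm ?subr_ge0 ?(ltW x1)//.
  by rewrite lerD2l lerN2.
- by move=> x x01; case: (dg x x01).
- apply: (AC_loc_derive d1g) => b0 b1.
  exists (4 * n.+1%:R * n.+2%:R * M / (1 - b0) ^+ 2).
  move=> x /andP[x0 xb]; have x1 := le_lt_trans xb b1.
  rewrite ler_pdivlMr ?exprn_gt0 ?subr_gt0//; have := @G2_norm _ n a M x aM.
  rewrite (ltW x0) x1 => /(_ isT); apply: le_trans.
  rewrite [leRHS]normrM [leRHS]mulrC ler_wpM2l// ger0_norm ?sqr_ge0//.
  by rewrite lerXn2r ?nnegrE ?subr_ge0 ?(ltW b1) ?(ltW x1)// lerD2l lerN2.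
- apply: (@Linfty_bounded_by _ (2 * n.+1%:R * M)); apply: bounded_by_ext (bounded_by_DtS n aM) => x x01.
  exact: Dt_ext.
Qed.

Lemma cvg_right0_S g n a M : (forall k, `|a k| <= M) ->
  (forall x, 0 <= x < 1 -> g x = Psum n a x) -> g x @[x --> 0^'+] --> g 0.
Proof.
move=> aM gS; apply/cvgrPdistC_le => e e0.
have x00 : 0 <= (0 : R) < 1 by rewrite lexx ltr01.
have [d d0 hd] := S_continuous n aM x00 e0.
near=> x.
have x0 : 0 < x by near: x; exact: nbhs_right_gt.
have x1 : x < 1 by near: x; exact: nbhs_right_lt.
rewrite !gS ?lexx ?ltr01 ?(ltW x0)//; apply: hd; first by rewrite ltW.
by rewrite subr0 gtr0_norm//; near: x; exact: nbhs_right_lt.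
Unshelve. all: by end_near. Qed.

End function_spaces.

(** * The converse inequality *)

Section converse_inequality.
Context {R : realType}.
Implicit Types (f g h : R -> R) (a : nat -> R) (M A c x : R) (n k m p : nat).

Lemma bounded_by_sub f g M A c : bounded_by f M -> bounded_by g A ->
  (forall x, 0 <= x < 1 -> `|f x - g x| <= c) -> bounded_by (f \- g) c.
Proof. by move=> fM gA fg; have [mfg _] := bounded_byB fM gA. Qed.

Lemma ut_sub m f g M A k : bounded_by f M -> bounded_by g A ->
  ut m.+1 (f \- g) k = ut m.+1 f k - ut m.+1 g k.
Proof.
move=> fM gA.
have E j : u m.+1 j (f \- g) = u m.+1 j f - u m.+1 j g.
  have bN := bounded_byZ (-1) gA.
  rewrite (_ : f \- g = fun t => f t + -1 * g t); last first.
    by apply/funext => t; rewrite mulN1r.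
  by rewrite (uD _ _ fM bN) (uZ _ _ _ gA) mulN1r.
by rewrite /ut /Delta !E; ring.
Qed.

Lemma Mt_sub m f g M A x : bounded_by f M -> bounded_by g A -> 0 <= x < 1 ->
  Mt m.+1 (f \- g) x = Mt m.+1 f x - Mt m.+1 g x.
Proof.
move=> fM gA x01.
rewrite (Mt_S_ut _ (bounded_byB fM gA) x01) (Mt_S_ut _ fM x01) (Mt_S_ut _ gA x01).
rewrite -[Psum m.+1 (ut m.+1 g) x]mul1r.
rewrite -(S_lin _ _ (fun k => ut_norm m k fM) (fun k => ut_norm m k gA))//.
by apply: S_ext => k; rewrite (ut_sub _ _ fM gA) mul1r.
Qed.

Lemma Dt_Mt_sub m f g M A x : bounded_by f M -> bounded_by g A -> 0 <= x < 1 ->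
  Dt (Mt m.+1 (f \- g)) x = Dt (Mt m.+1 f) x - Dt (Mt m.+1 g) x.
Proof.
move=> fM gA x01.
rewrite (Dt_Mt_S _ (bounded_byB fM gA) x01) (Dt_Mt_S _ fM x01) (Dt_Mt_S _ gA x01).
have [_ h1 _ _] := S_Delta m.+1 (fun k => ut_norm m k fM) x01.
have [_ h2 _ _] := S_Delta m.+1 (fun k => ut_norm m k gA) x01.
apply: S_unique; apply: has_sum_ext (has_sumB h1 h2) => k.
by rewrite /Delta !(ut_sub _ _ fM gA); ring.
Qed.

Local Opaque Dt Mt.

Lemma converse_inequality m p f M (alpha beta : R) : bounded_by f M ->
  (80 * m.+2 <= p.+2)%N ->
  (forall x, 0 <= x < 1 -> `|Mt m.+2 f x - f x| <= alpha) ->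
  (forall x, 0 <= x < 1 -> `|Mt p.+2 f x - f x| <= beta) ->
  (K f (m.+2%:R ^+ 2)^-1 <=
    (100 ^+ 2 * (p.+2%:R ^+ 2 / m.+2%:R ^+ 2) * (alpha + beta))%:E)%E.
Proof.
(* The arithmetic is isolated over generic reals, away from the iterated operators. *)
have ar1 (a b : R) : 9 * (91 * a) + b + 91 * a = 910 * a + b by ring.
have ar2 (a b c d : R) : a - b = - (c - a) + (c - d) + (d - b) by ring.
have ar0 (a b c d : R) : a - d = (a - b) + (b - c) + (c - d) by ring.
have ar91 (a : R) : 91 * a = a + 9 * a + 81 * a by ring.
have ar81 (a : R) : 81 * a = 9 * (9 * a) by ring.
have ar3 (z y x : R) : 80 * z * x <= y * x -> 40 * z * x <= x / 2 * y by lra.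
have ar4 (y z : R) : y * z <= y * (2 * y) -> 2 * (y * z) <= 4 * y ^+ 2.
  by rewrite expr2; lra.
have ar5 (s y z a w : R) : s <= (s + 40 * z * (40 * z * a)) / 2 + 4 * y * w ->
    s <= 1600 * z ^+ 2 * a + 8 * y * w by rewrite expr2; lra.
(* The constant of the theorem: 91 + 1600 + 7280 q <= 8971 q, rounded up to 100^2. *)
have ar6 (z a b q : R) : 0 <= a -> 0 <= b -> 1 <= q ->
    z <= 1600 * a + 8 * q * (910 * a + b) -> 91 * a + z <= 100 ^+ 2 * q * (a + b).
  move=> a0 b0 q1; have := ler_wpM2r a0 q1.
  have := mulr_ge0 (le_trans ler01 q1) b0; lra.
have ar8 (z y a b : R) : 0 < z ->
    1600 * a + 8 * (y / z ^+ 2) * b = (z ^+ 2)^-1 * (1600 * z ^+ 2 * a + 8 * y * b).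
  by move=> z0; field; rewrite gt_eqF.
have ar7 (y z : R) : 0 < z -> 80 * z <= y -> z <= y by lra.
have l1 : p.+3%:R <= 2 * p.+2%:R :> R by rewrite -natrM ler_nat; lia.
move=> fM np Ta Tb; set n := m.+2 in np Ta *; set l := p.+2 in np Tb l1 *.
have x00 : 0 <= (0 : R) < 1 by rewrite lexx ltr01.
have a0 : 0 <= alpha by apply: le_trans (Ta 0 x00).
have b0 : 0 <= beta by apply: le_trans (Tb 0 x00).
have [g1 g1E] : exists g, g = Mt n f by exists (Mt n f).
have [g2 g2E] : exists g, g = Mt n g1 by exists (Mt n g1).
have [h hE] : exists g, g = Mt n g2 by exists (Mt n g2).
have bg1 : bounded_by g1 (9 * M) by rewrite g1E; exact: bounded_by_Mt fM.
have bg2 : bounded_by g2 (9 * (9 * M)) by rewrite g2E; exact: bounded_by_Mt bg1.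
have bh : bounded_by h (9 * (9 * (9 * M))) by rewrite hE; exact: bounded_by_Mt bg2.
rewrite -/n -g1E in Ta.
have bd1 : bounded_by (f \- g1) alpha.
  by apply: (bounded_by_sub fM bg1) => x x01; rewrite distrC; exact: Ta.
have E1 x : 0 <= x < 1 -> g1 x - g2 x = Mt n (f \- g1) x.
  by move=> x01; rewrite (Mt_sub _ fM bg1 x01) -g1E -g2E.
have bd2 : bounded_by (g1 \- g2) (9 * alpha).
  by apply: bounded_by_ext (bounded_by_Mt m.+1 bd1).
have E2 x : 0 <= x < 1 -> g2 x - h x = Mt n (g1 \- g2) x.
  by move=> x01; rewrite (Mt_sub _ bg1 bg2 x01) -g2E -hE.
have bd3 : bounded_by (g2 \- h) (81 * alpha).
  by rewrite ar81; exact: bounded_by_ext (bounded_by_Mt m.+1 bd2).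
(* 91 = 1 + 9 + 81: f - h telescopes through [g1] and [g2], and each application of [Mt n] costs a
   factor 9. *)
have fh x : 0 <= x < 1 -> `|f x - h x| <= 91 * alpha.
  move=> x01; have [_ d1] := bd1; have [_ d2] := bd2; have [_ d3] := bd3.
  have {}d1 := d1 x x01; have {}d2 := d2 x x01; have {}d3 := d3 x x01.
  rewrite (ar0 _ (g1 x) (g2 x)) ar91.
  apply: le_trans (ler_normD _ _) _; rewrite lerD//.
  by apply: le_trans (ler_normD _ _) _; rewrite lerD.
(* f is inserted between [Mt l h] and h; 910 = 9 * 91 + 91. *)
have lh x : 0 <= x < 1 -> `|Mt l h x - h x| <= 910 * alpha + beta.
  move=> x01; have bfh := bounded_by_sub fM bh fh.
  have [_ /(_ x x01)] := bounded_by_Mt p.+1 bfh.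
  rewrite (Mt_sub _ fM bh x01) => d1; have d2 := Tb x x01; have d3 := fh x x01.
  rewrite (ar2 _ _ (Mt l f x) (f x)).
  apply: le_trans (ler_normD _ _) _.
  apply: le_trans (lerD (ler_normD _ _) (lexx _)) _; rewrite normrN.
  by apply: le_trans (lerD (lerD d1 d2) d3) _; rewrite ar1.
have bDg1 := bounded_by_Dt_Mt m.+1 fM; rewrite -/n -g1E in bDg1.
have bDg2 := bounded_by_Dt_Mt m.+1 bg1; rewrite -/n -g2E in bDg2.
have g1S x : 0 <= x < 1 -> g1 x = Psum n (ut n f) x by rewrite g1E; exact: Mt_S_ut fM.
have g2S x : 0 <= x < 1 -> g2 x = Psum n (ut n g1) x by rewrite g2E; exact: Mt_S_ut bg1.
have hS x : 0 <= x < 1 -> h x = Psum n (ut n g2) x by rewrite hE; exact: Mt_S_ut bg2.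
have Dg2 x : 0 <= x < 1 -> Dt g2 x = Mt n (Dt g1) x.
  by move=> x01; rewrite g2E; exact: (Dt_Mt_commute _ (fun k => ut_norm m.+1 k fM) g1S x01).
have Dh x : 0 <= x < 1 -> Dt h x = Mt n (Dt g2) x.
  by move=> x01; rewrite hE; exact: (Dt_Mt_commute _ (fun k => ut_norm m.+1 k bg1) g2S x01).
have Dg2S x : 0 <= x < 1 -> Dt g2 x = Psum n (ut n (Dt g1)) x.
  by move=> x01; rewrite (Dg2 x x01); exact: Mt_S_ut bDg1 x01.
have DhS x : 0 <= x < 1 -> Dt h x = Psum n (ut n (Dt g2)) x.
  by move=> x01; rewrite (Dh x x01); exact: Mt_S_ut bDg2 x01.
have DDg2 x : 0 <= x < 1 -> Dt (Dt g2) x = Dt (Mt n (Dt g1)) x.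
  by move=> x01; exact: (Dt_ext x01 Dg2).
have bDDg2 : bounded_by (Dt (Dt g2)) _ := bounded_by_ext DDg2 (bounded_by_Dt_Mt m.+1 bDg1).
have DDh' x : 0 <= x < 1 -> Dt (Dt h) x = Dt (Mt n (Dt g2)) x.
  by move=> x01; exact: (Dt_ext x01 Dh).
have DDh x : 0 <= x < 1 -> Dt (Dt h) x = Mt n (Dt (Dt g2)) x.
  move=> x01; rewrite (DDh' x x01).
  exact: (Dt_Mt_commute _ (fun k => ut_norm m.+1 k bDg1) Dg2S x01).
have DDhS x : 0 <= x < 1 -> Dt (Dt h) x = Psum n (ut n (Dt (Dt g2))) x.
  by move=> x01; rewrite (DDh x x01); exact: Mt_S_ut bDDg2 x01.
have bDDh : bounded_by (Dt (Dt h)) _ := bounded_by_ext DDh' (bounded_by_Dt_Mt m.+1 bDg2).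
(* Absorbing a multiple of this norm is legitimate only if it is finite, which the crude bound
   [bDDh] guarantees. *)
have [Es sP] : (fine (unif_norm (Dt (Dt h))))%:E = unif_norm (Dt (Dt h)) /\
    forall x, 0 <= x < 1 -> `|Dt (Dt h) x| <= fine (unif_norm (Dt (Dt h))).
  by apply: fine_unif_norm; case: bDDh => _; exact.
set s := fine _ in Es sP.
have s0 : 0 <= s by apply: le_trans (sP 0 x00).
(* [Dt (Mt n _)] is linear of norm at most [40 n], and
   [Dt (Dt g2) - Dt (Dt h)] is its square applied to [f \- g1] *)
have bD12 : bounded_by (Dt g1 \- Dt g2) (40 * n%:R * alpha).
  apply: (bounded_by_sub bDg1 bDg2) => x x01.
  have [_ /(_ x x01)] := bounded_by_Dt_Mt m.+1 bd1.
  by rewrite (Dt_Mt_sub _ fM bg1 x01) -g1E -g2E.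
have DD23 x : 0 <= x < 1 ->
    `|Dt (Dt g2) x - Dt (Dt h) x| <= 40 * n%:R * (40 * n%:R * alpha).
  move=> x01; have [_ /(_ x x01)] := bounded_by_Dt_Mt m.+1 bD12.
  rewrite (Dt_Mt_sub _ bDg1 bDg2 x01) => H.
  have E := f_equal2 (fun y z : R => y - z) (DDg2 x x01) (DDh' x x01).
  exact: (eq_ind_r (fun z => `|z| <= _) H E).
(* A bound on D^2 [g2] through the unknown s. Since D^3 h is D [Mt n] applied to D^2 [g2], the bound
   40 n X on D^3 h also contains s. *)
pose X := s + 40 * n%:R * (40 * n%:R * alpha).
have bX : bounded_by (Dt (Dt g2)) X.
  split; first by case: bDDg2.
  move=> x x01; rewrite -[Dt (Dt g2) x](subrK (Dt (Dt h) x)) addrC.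
  by apply: le_trans (ler_normD _ _) _; rewrite lerD ?sP ?DD23.
have bDDDh : bounded_by (Dt (Dt (Dt h))) (40 * n%:R * X).
  by apply: bounded_by_ext (bounded_by_Dt_Mt m.+1 bX) => x x01; exact: (Dt_ext x01 DDh).
have n0 : 0 < n%:R :> R by [].
have l0 : 0 < l%:R :> R by [].
have nl : 80 * n%:R <= l%:R :> R by rewrite -natrM ler_nat.
(* As l >= 80 n, the error 40 n X / l is at most X / 2, so s / 2 moves to the left. The factor 4 l^2
   bounds 2 l (l + 1). *)
have sle : s <= 1600 * n%:R ^+ 2 * alpha + 8 * l%:R ^+ 2 * (910 * alpha + beta).
  have : s <= X / 2 + 4 * l%:R ^+ 2 * (910 * alpha + beta).
    rewrite -lee_fin Es; apply: unif_norm_le => x x01.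
    have := voronovskaya_le p (fun k => ut_norm m.+1 k bg2)
      (fun k => ut_norm m.+1 k bDg2) (fun k => ut_norm m.+1 k bDDg2)
      hS DhS DDhS (fun y _ => erefl) (fun y _ => erefl) bDDDh x01.
    move/le_trans; apply; apply: lerD.
      rewrite ler_pdivrMr//; apply: ar3.
      by rewrite ler_wpM2r// (bounded_by_ge0 bX).
    apply: ler_pM => //; last exact: lh.
    by apply: ar4; rewrite ler_wpM2l.
  exact: ar5.
have hK : (K f (n%:R ^+ 2)^-1 <= (91 * alpha)%:E + ((n%:R ^+ 2)^-1 * s)%:E)%E.
  apply: (@le_trans _ _ (unif_norm (f \- h)%R + ((n%:R ^+ 2)^-1)%:E * ess_norm (Dt (Dt h)))%E).
    apply: ereal_inf_lbound; exists h => //=; split.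
    - exact: cvg_right0_S (fun k => ut_norm m.+1 k bg2) hS.
    - split; first exact: W2_S (fun k => ut_norm m.+1 k bg2) hS.
      (* D h agrees on [0,1) with an expansion, hence is right-continuous at 0, where it vanishes
         with [phi]: the condition of [W2_0]. *)
      have cD := cvg_right0_S (fun k => ut_norm m.+1 k bDg2) DhS.
      by rewrite Dt0 in cD.
    - exact: W2_S (fun k => ut_norm m.+1 k bDg2) DhS.
  apply: leeD; first exact: unif_norm_le.
  rewrite EFinM; apply: lee_wpmul2l; first by rewrite lee_fin invr_ge0 exprn_ge0.
  exact: ess_norm_le.
apply: le_trans hK _; rewrite -EFinD lee_fin.
have q1 : 1 <= l%:R ^+ 2 / n%:R ^+ 2 :> R.
  rewrite ler_pdivlMr ?exprn_gt0// mul1r lerXn2r ?nnegrE//.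
  exact: ar7.
have : (n%:R ^+ 2)^-1 * s <= 1600 * alpha + 8 * (l%:R ^+ 2 / n%:R ^+ 2) * (910 * alpha + beta).
  rewrite ar8//.
  by rewrite ler_wpM2l// invr_ge0 exprn_ge0.
exact: ar6.
Qed.

End converse_inequality.

Theorem theorem1p2 (R : realType) :
  exists C L : R, [/\ 0 < C, 0 < L &
    forall f : R -> R,
      {within `[0, 1[, continuous f} ->
      (exists M : R, forall x : R, 0 <= x < 1 -> `|f x| <= M) ->
      forall n l : nat, (17 <= n)%N -> L * n%:R <= l%:R ->
      (K f (n%:R ^+ 2)^-1 <=
        (C * (l%:R ^+ 2 / n%:R ^+ 2))%:E *
        (unif_norm (Mt n f \- f)%R + unif_norm (Mt l f \- f)%R))%E].
Proof.
exists (100 ^+ 2), 80; split=> [//|//|] f cf [M fM] n l n17 nl.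
have bf : bounded_by f M.
  split=> //; apply: (@measurable_funS _ _ _ _ (`[0, 1[%classic : set R)) => //.
    exact: subset_itv_oo_co.
  exact: subspace_continuous_measurable_fun.
have nl' : (80 * n <= l)%N by rewrite -(ler_nat R) natrM.
(* Both indices are at least 2, the form in which D commutes with the operators. *)
case: n n17 nl nl' => [|[|m]]// _ _; case: l => [|[|p]]; rewrite ?muln_gt0// => nl.
have bound q : exists A, forall x, 0 <= x < 1 -> `|(Mt q.+2 f \- f) x| <= A.
  have [_ bA] := bounded_byB (bounded_by_Mt q.+1 bf) bf; by exists (9 * M + M).
have [A1 hA1] := bound m; have [A2 hA2] := bound p.
have [E1 Ta] := fine_unif_norm hA1; have [E2 Tb] := fine_unif_norm hA2.
have H := converse_inequality bf nl Ta Tb; rewrite EFinM EFinD in H.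
exact: (eq_ind _ (fun U => (_ <= _ * (U + _))%E)
  (eq_ind _ (fun U => (_ <= _ * (_ + U))%E) H _ E2) _ E1).
Qed.
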